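(* Let $T$ be the stream length, let $\rho>0$, and let $n=2^K$ with $K\in\mathbb{N}$ and $n\le \mathrm{poly}(T)$. There exists a randomized streaming algorithm for the continual distinct elements problem over the universe $[n]$ which satisfies $\rho$-zCDP with respect to event-level neighboring streams and uses $O(\log n\cdot \log^2 T)$ words of space. Moreover, there is an absolute constant $c>0$ such that if $\rho\le c\log^4 T$, then on every strict turnstile stream of length $T$, with probability $1-1/\mathrm{poly}(T)$ the algorithm solves continual distinct elements estimation with $(\alpha,\beta)$ error where $\alpha=O(\log^2(T)/\sqrt{\rho})$ and $\beta=O(\log^2(T)/\sqrt{\rho})$.
   Context: A (general turnstile) stream of length $T$ over universe $[n]$ is a sequence $(a_1,s_1),\dots,(a_T,s_T)$ with $a_i\in[n]$ and $s_i\in\{-1,0,1\}$. The frequency vector $x_t\in\mathbb{Z}^n$ has $x_t[j]=\sum_{i\le t: a_i=j}s_i$. The stream is strict turnstile if $x_t[j]\ge 0$ for all $j,t$. The number of distinct elements at time $t$ is $D_t=\|x_t\|_0=|\{j: x_t[j]\neq 0\}|$. In the continual problem the algorithm processes updates one at a time and must output an estimate $\hat D_t$ after the $t$-th update for every $t\in[T]$. The algorithm has $(\alpha,\beta)$ error (for $\alpha\ge1,\beta\ge0$) if there exist $p,q\ge1$ with $pq=\alpha$ and $r,s\ge 0$ with $r+s=\beta$ such that $D_t/p-r\le \hat D_t\le qD_t+s$ for all $t\in[T]$; ''with probability $1-\gamma$'' means these bounds hold simultaneously for all $t$ with that probability over the algorithm's randomness (the stream is fixed in advance, independent of the algorithm's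 randomness). Two streams are event-level neighbors if they differ in exactly one update $(a_i,s_i)$. For distributions $P,Q$ and $\zeta>1$, the Rényi divergence is $D_\zeta(P\|Q)=\frac{1}{\zeta-1}\log \mathbb{E}_{z\sim P}[(P(z)/Q(z))^{\zeta-1}]$; a randomized algorithm $\mathcal{A}$ is $\rho$-zCDP if $D_\zeta(\mathcal{A}(X)\|\mathcal{A}(X'))\le\rho\zeta$ for all neighboring $X,X'$ and all $\zeta\in(1,\infty)$ (here the output is the whole sequence of estimates). Space is measured in words of $\Omega(\log T)$ bits; sampling a one-dimensional Gaussian is assumed to be an available constant-space primitive. *)

(* Defs.v *)
From HB Require Import structures.
From mathcomp Require Import all_boot all_order all_algebra.
From mathcomp Require Import all_classical all_reals all_analysis.

Set Implicit Arguments.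
Unset Strict Implicit.
Unset Printing Implicit Defensive.

Import Order.TTheory GRing.Theory Num.Theory.

Local Open Scope ring_scope.

Section Streams.
Variables n T : nat.

Definition increment := seq_sub ([:: -1; 0; 1] : seq int).
Definition update := ('I_n * increment)%type.

(* Times are 0-based: x t is the update that is processed (t+1)-st. *)
Definition stream := 'I_T -> update.

(* The frequency of j after processing x 0, ..., x t (t included). *)
Definition freq (x : stream) (t : 'I_T) (j : 'I_n) : int :=
  \sum_(i < T | (i <= t)%N && ((x i).1 == j)) ssval (x i).2.

Definition strict_turnstile (x : stream) : Prop := forall t j, 0 <= freq x t j.

Definition distinct (x : stream) (t : 'I_T) : nat :=
  #|[pred j | freq x t j != 0]|.

Definition event_neighbors (x x' : stream) : Prop :=
  #|[pred i | x i != x' i]| = 1%N.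

End Streams.

Section FiniteLaws.
Variable R : realType.

Record finite_law (S : finType) := FiniteLaw {
  mass :> S -> R;
  mass_ge0 : forall s, 0 <= mass s;
  mass_sum1 : \sum_s mass s = 1 }.

(* Renyi divergence of order zeta between two discrete laws given by their
   mass functions:
     (zeta - 1)^-1 * log (E_{z ~ P} [(P z / Q z) `^ (zeta - 1)]).
   The ratio is +oo where Q z = 0; as 0 * +oo = 0 in \bar R, a z with
   P z = 0 contributes nothing, so the divergence is +oo exactly when P is
   not dominated by Q or the expectation diverges. *)
Definition renyi (Z : choiceType) (zeta : R) (P Q : Z -> R) : \bar R :=
  (((zeta - 1)^-1)%:E *
   lne (\esum_(z in [set: Z]%classic)
          ((P z)%:E * (if (Q z == 0)%R then +oo
                       else ((P z / Q z) `^ (zeta - 1))%R%:E))))%E.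

End FiniteLaws.

Section Algorithms.
Variable R : realType.

Definition memory (m w : nat) := m.-tuple (w.-tuple bool).

(* A randomized streaming algorithm over the universe [n] using m words of w
   bits. The memory is all that survives from one update to the next: random
   bits or noise that are to be used again (hash seeds, stored noisy sums)
   and the position in the stream all have to be kept in the m words.
   A transition may use any fresh randomness. Since the memory is finite, every
   law on it is the law of a function of one Gaussian sample, so this is
   what an available Gaussian primitive provides; the value read
   from the sample is stored with the finite precision of the words. *)
Record streaming_algorithm (n m w : nat) := StreamingAlgorithm {
  init : finite_law R (memory m w);
  step : memory m w -> update n -> finite_law R (memory m w);
  estimate : memory m w -> R }.

Variables (n m w T : nat) (A : streaming_algorithm n m w).

(* A run lists the T+1 memory contents; widen_ord/lift turn a time t < T into
   the indices t and t+1. *)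
Definition run := {ffun 'I_T.+1 -> memory m w}.

Definition run_prob (x : stream n T) (s : run) : R :=
  init A (s ord0) *
  \prod_(t < T) step A (s (widen_ord (leqnSn T) t)) (x t) (s (lift ord0 t)).

Definition outputs (s : run) : {ffun 'I_T -> R} :=
  [ffun t => estimate A (s (lift ord0 t))].

(* The probability that the whole output sequence on x satisfies E. *)
Definition output_prob (x : stream n T) (E : pred {ffun 'I_T -> R}) : R :=
  \sum_(s : run | E (outputs s)) run_prob x s.

Definition output_law (x : stream n T) (z : {ffun 'I_T -> R}) : R :=
  output_prob x (pred1 z).

Definition zCDP (rho : R) : Prop :=
  forall x x' : stream n T, event_neighbors x x' ->
  forall zeta : R, 1 < zeta ->
  (renyi zeta (output_law x) (output_law x') <= (rho * zeta)%:E)%E.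

(* On the stream x, with probability at least 1 - gamma, A has
   (alpha, beta) error at all times simultaneously. *)
Definition solves_distinct_elements (x : stream n T) (alpha beta gamma : R)
    : Prop :=
  exists p q r s : R,
    [/\ 1 <= p, 1 <= q & p * q = alpha] /\
    [/\ 0 <= r, 0 <= s & r + s = beta] /\
    1 - gamma <= output_prob x (fun z => [forall t : 'I_T,
      ((distinct x t)%:R / p - r <= z t) &&
      (z t <= q * (distinct x t)%:R + s)]).

End Algorithms.

Arguments zCDP {R n m w} T A rho.

(* Main.v *)
Require Import Defs.
From HB Require Import structures.
From mathcomp Require Import all_boot all_order all_algebra.
From mathcomp Require Import all_classical all_reals all_analysis.
From mathcomp Require finfield.
From mathcomp Require Import zify ring lra.

(* Idea: every seed hashes each element j to level k with probability
   2^-(k+1), pairwise independently. For each of O(log T) independent seeds and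
   each level, the total frequency of the elements of that level is released by
   the binary tree mechanism. In a strict turnstile stream this total is 0 if
   the level contains no present element and is at least their number
   otherwise. So if D is well below 2^k, most seeds show only noise at level k,
   and if D is well above tau 2^k, where tau exceeds the noise, most seeds show
   more than tau. The largest 2^k at which most seeds exceed the threshold is
   therefore within O(tau) of D.
   Gaussian noise is replaced by geometric noise wrapped around Z/M: then all
   values are bounded, a shift of one unit changes the law of a node by a factor
   at most exp(eps) everywhere, and a sum of O(log T) such noises is still
   O(log T / eps) with high probability. An update touches one level per seed,
   hence O(log^2 T) nodes, and eps of order sqrt rho / log T suffices. *)

Set Implicit Arguments.
Unset Strict Implicit.
Unset Printing Implicit Defensive.

Import Order.TTheory GRing.Theory Num.Theory.

Local Open Scope ring_scope.

(** * Renyi divergence of finite laws *)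

Section Inequalities.
Variable R : realType.
Implicit Types (s d e b zeta : R).

Lemma powRE_expR (x : R) s : 0 < x -> x `^ s = expR (s * ln x).
Proof. by move=> x0; rewrite mulrC expRM lnK// posrE. Qed.

Lemma powR_prod (I : Type) (r : seq I) (F : I -> R) s : (forall i, 0 <= F i) ->
  (\prod_(i <- r) F i) `^ s = \prod_(i <- r) F i `^ s.
Proof.
move=> F0; elim: r => [|i r IH]; first by rewrite !big_nil powR1.
by rewrite !big_cons powRM ?IH// prodr_ge0.
Qed.

(** This is the tangent at 1 of a convex function: [1 + u <= expR u] is applied to [u = - s * ln x],
    then [ln x <= x - 1]. *)
Lemma powRN_ge_tangent s (x : R) : 0 <= s -> 0 < x -> 1 - s * (x - 1) <= x `^ (- s).
Proof.
move=> s0 x0; rewrite powRE_expR// (le_trans _ (expR_ge1Dx _))// mulNr lerD2l.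
rewrite lerN2 ler_wpM2l//; have := @le_ln1Dx R (x - 1).
by rewrite (addrC 1) subrK; apply; rewrite ltrBrDl subrr.
Qed.

(** The generous constant 2 permits an elementary proof: [d <= 2 * d ^+ 2] once [d >= 1 / 2], and
    for smaller [d] the exponentials are bounded by [(1 - d)^-1] and [(1 + d)^-1]. *)
Lemma cosh_le_expR_sqr d : (expR d + expR (- d)) / 2 <= expR (2 * d ^+ 2).
Proof.
wlog d0 : d / 0 <= d.
  move=> H; have [/H//|/ltW d0] := leP 0 d.
  by have := H (- d); rewrite sqrrN opprK (addrC (expR (- d))); apply; lra.
have [dh|dh] := leP (1 / 2) d.
  have : expR (- d) <= expR d by rewrite ler_expR; lra.
  have : expR d <= expR (2 * d ^+ 2) by rewrite ler_expR; nra.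
  lra.
have e1 : expR d <= (1 - d)^-1.
  rewrite -[expR d]invrK lef_pV2 ?posrE ?invr_gt0 ?expR_gt0//; last lra.
  by rewrite -expRN expR_ge1Dx.
have e2 : expR (- d) <= (1 + d)^-1.
  by rewrite expRN lef_pV2 ?posrE ?expR_gt0 ?expR_ge1Dx//; lra.
apply: (le_trans _ (expR_ge1Dx _)).
have -> : 1 + 2 * d ^+ 2 = (2 + 4 * d ^+ 2) / 2 by field.
rewrite ler_pM2r//.
apply: (le_trans (lerD e1 e2)).
have -> : (1 - d)^-1 + (1 + d)^-1 = 2 / (1 - d ^+ 2).
  by field; rewrite !gt_eqF//; nra.
have d2 : d ^+ 2 <= 1 / 4 by nra.
have dd : 0 <= d ^+ 2 by exact: sqr_ge0.
by rewrite ler_pdivrMr; [nra|lra].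
Qed.

(* [expR (- s * e)] and [expR (s * e)] are the values of [v |-> v `^ (- s)] at
   the end points; the two tangents at [v] give the chord bound. *)
Lemma powRN_le_chord s e (v : R) : 0 <= s -> 0 < e ->
  expR (- e) <= v <= expR e ->
  (expR e - expR (- e)) * v `^ (- s) <=
  (v - expR (- e)) * expR (- (s * e)) + (expR e - v) * expR (s * e).
Proof.
move=> s0 e0 /andP[v1 v2].
have v0 : 0 < v by rewrite (lt_le_trans (expR_gt0 _) v1).
(* By homogeneity the tangent at 1 gives the one at [v]. With weights [v - expR (- e)] and
   [expR e - v] at the two end points the slopes cancel. *)
have tan y : 0 < y -> v `^ (- s) * (1 - s * (y / v - 1)) <= y `^ (- s).
  move=> y0; have := powRN_ge_tangent s0 (divr_gt0 y0 v0) => H.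
  have -> : y `^ (- s) = v `^ (- s) * (y / v) `^ (- s).
    rewrite -powRM ?(ltW v0) ?divr_ge0 ?(ltW y0) ?(ltW v0)//.
    by rewrite mulrC divfK// gt_eqF.
  by rewrite ler_wpM2l ?powR_ge0.
have A : expR (- (s * e)) = expR e `^ (- s).
  by rewrite powRE_expR ?expR_gt0// expRK mulNr.
have B : expR (s * e) = expR (- e) `^ (- s).
  by rewrite powRE_expR ?expR_gt0// expRK mulrNN.
rewrite A B.
have := ler_wpM2l (_ : 0 <= v - expR (- e)) (tan _ (expR_gt0 e)).
have := ler_wpM2l (_ : 0 <= expR e - v) (tan _ (expR_gt0 (- e))).
rewrite !subr_ge0 => /(_ v2) H1 /(_ v1) H2.
apply: le_trans (lerD H2 H1).
rewrite le_eqVlt; apply/orP; left; apply/eqP.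
by field; apply: lt0r_neq0.
Qed.

(* [q / p] has mean 1 under [p] and lies in [[exp (- e), exp e]], so by the chord
   bound the worst case is the two-point law on the end points. *)
Lemma ratio_moment_le (X : finType) (p q : X -> R) e zeta :
  (forall x, 0 < p x) -> (forall x, 0 < q x) ->
  \sum_x p x = 1 -> \sum_x q x = 1 -> 0 <= e -> 1 < zeta ->
  (forall x, p x <= expR e * q x) -> (forall x, q x <= expR e * p x) ->
  \sum_x p x * (p x / q x) `^ (zeta - 1) <=
  expR (2 * e ^+ 2 * (zeta * (zeta - 1))).
Proof.
move=> p0 q0 p1 q1 e0 z1 pq qp; set s := zeta - 1.
have s0 : 0 < s by rewrite /s; lra.
(* For [e = 0] the chord degenerates, but then the two laws coincide. *)
move: e0; rewrite le_eqVlt => /predU1P[e0|e0].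
  rewrite -e0 expr0n/= !(mulr0, mul0r) expR0 -p1 le_eqVlt; apply/orP; left.
  apply/eqP; apply: eq_bigr => x _.
  have -> : q x = p x.
    by apply/eqP; rewrite eq_le; have := pq x; have := qp x;
       rewrite -e0 expR0 !mul1r => -> ->.
  by rewrite divff ?powR1 ?mulr1// gt_eqF.
set A := expR e; set B := expR (- e).
have AB : A * B = 1 by rewrite -expRD subrr expR0.
have A1 : 1 < A by rewrite expR_gt1.
have B0 : 0 < B := expR_gt0 _.
have AB0 : 0 < A - B by nra.
have chord : (A - B) * (\sum_x p x * (p x / q x) `^ s) <=
    (1 - B) * expR (- (s * e)) + (A - 1) * expR (s * e).
  rewrite mulr_sumr.
  apply: (@le_trans _ _ (\sum_x ((q x - B * p x) * expR (- (s * e)) +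
     (A * p x - q x) * expR (s * e)))); last first.
    rewrite big_split/= -!mulr_suml !sumrB -!mulr_sumr p1 q1 !mulr1; lra.
  apply: ler_sum => x _.
  have -> : (p x / q x) `^ s = (q x / p x) `^ (- s).
    rewrite !powRE_expR ?divr_gt0// ?posrE//.
    by rewrite -[p x / q x]invf_div lnV ?posrE ?divr_gt0// mulrN mulNr.
  have := @powRN_le_chord s e (q x / p x) (ltW s0) e0.
  rewrite ler_pdivlMr// ler_pdivrMr// qp andbT => /(_ _)/wrap[].
    rewrite -/B; have := ler_wpM2l (ltW B0) (pq x).
    by rewrite mulrA -/A (mulrC B A) AB mul1r.
  rewrite -/A -/B => H; have := ler_wpM2l (ltW (p0 x)) H.
  have := p0 x; move: (expR _) (expR _) (powR _ _) => u v w px H1.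
  have -> : (A - B) * (p x * w) = p x * ((A - B) * w) by ring.
  apply: (le_trans H1); rewrite le_eqVlt; apply/orP; left; apply/eqP.
  by field; exact: lt0r_neq0.
set m := \sum_x _ in chord *.
set E := expR (s * e) in chord; set F := expR (- (s * e)) in chord.
have E0 : 0 < E := expR_gt0 _.
have F0 : 0 < F := expR_gt0 _.
have EF : E * F = 1 by rewrite -expRD subrr expR0.
(* Since [A * B = 1], the weights simplify to [(1 - B) / (A - B) = 1 / (A + 1)] and
   [(A - 1) / (A - B) = A / (A + 1)]. *)
have mle : m * (A + 1) <= F + A * E.
  rewrite -(ler_pM2l AB0).
  have -> : (A - B) * (m * (A + 1)) = ((A - B) * m) * (A + 1) by ring.
  have A10 : 0 < A + 1 by lra.
  apply: (le_trans (ler_wpM2r (ltW A10) chord)).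
  have -> : B = A^-1 by rewrite /B expRN.
  rewrite le_eqVlt; apply/orP; left; apply/eqP.
  by field; apply: lt0r_neq0; lra.
have sh : E - F <= 2 * (s * e) * (E + F).
  have : 1 - 2 * (s * e) <= F * F.
    rewrite -expRD; apply: le_trans (expR_ge1Dx _); lra.
  nra.
have th : A - 1 <= e * (A + 1).
  have : 1 - e <= B := expR_ge1Dx _.
  nra.
have ch := cosh_le_expR_sqr (s * e); rewrite -/E -/F in ch.
have se0 : 0 < s * e by rewrite mulr_gt0.
(* Here [(F + A * E) / (A + 1)] equals [(E + F) / 2 + (A - 1) / (A + 1) * (E - F) / 2], that is cosh
   plus tanh times sinh; [th] and [sh] control the second summand. *)
have key : m <= (E + F) / 2 * (1 + 2 * (s * e) * e).
  have A10 : 0 < A + 1 by lra.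
  rewrite -(ler_pM2r A10); apply: (le_trans mle).
  have EF2 : E >= F by rewrite ler_expR; lra.
  have : (A - 1) * (E - F) <= e * (A + 1) * (2 * (s * e) * (E + F)).
    by rewrite ler_pM//; lra.
  lra.
apply: (le_trans key).
apply: (@le_trans _ _ (expR (2 * (s * e) ^+ 2) * expR (2 * (s * e) * e))).
  rewrite ler_pM ?expR_ge1Dx//; nra.
rewrite -expRD ler_expR /s; nra.
Qed.

(* Jensen for the convex function [t |-> t `^ (- s)], by its tangent at 1. *)
Lemma fiber_moment_le (X : finType) (p q : X -> R) (D : pred X) s :
  (forall x, 0 < p x) -> (forall x, 0 < q x) -> 0 <= s ->
  (\sum_(x | D x) p x) * ((\sum_(x | D x) p x) / (\sum_(x | D x) q x)) `^ s <=
  \sum_(x | D x) p x * (p x / q x) `^ s.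
Proof.
move=> p0 q0 s0.
case: (pickP D) => [x0 Dx0|D0]; last by rewrite !big_pred0// mul0r.
have Pgt (f : X -> R) : (forall x, 0 < f x) -> 0 < \sum_(x | D x) f x.
  move=> f0; rewrite (bigD1 x0)//= ltr_wpDr// sumr_ge0// => x _; exact: ltW.
set P := \sum_(x | D x) p x; set Q := \sum_(x | D x) q x.
have P0 : 0 < P := Pgt _ p0.
have Q0 : 0 < Q := Pgt _ q0.
(* The tangent is taken in the variable [q x / p x * (P / Q)], whose mean under [p / P] on the fiber
   is 1, so the linear terms sum to 0. *)
have term x : p x * (P / Q) `^ s * (1 - s * ((q x / p x) * (P / Q) - 1)) <=
    p x * (p x / q x) `^ s.
  have t0 : 0 < q x / p x * (P / Q) by rewrite mulr_gt0// divr_gt0.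
  rewrite -mulrA ler_wpM2l ?(ltW (p0 _))//.
  have -> : (p x / q x) `^ s = (P / Q) `^ s * (q x / p x * (P / Q)) `^ (- s).
    rewrite !powRE_expR ?divr_gt0// -expRD; congr expR.
    rewrite (@lnM _ (q x / p x)) ?posrE ?divr_gt0// !ln_div ?posrE//.
    ring.
  by rewrite ler_wpM2l ?powR_ge0//; exact: powRN_ge_tangent.
apply: le_trans (ler_sum _ (fun x _ => term x)).
rewrite le_eqVlt; apply/orP; left; apply/eqP.
rewrite (eq_bigr (fun x => (P / Q) `^ s * ((1 + s) * p x - s * (P / Q) * q x))).
  rewrite -mulr_sumr sumrB -!mulr_sumr -/P -/Q.
  by move: (powR _ _) => c; field; exact: lt0r_neq0.
by move=> x _; field; apply/andP; split; exact: lt0r_neq0.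
Qed.

(** Data processing: a moment bound for the noise passes to any function [G] of it, fiber by
    fiber. *)
Lemma renyi_pushforward_le (X : finType) (Z : choiceType) (p q : X -> R)
    (G : X -> Z) (P Q : Z -> R) zeta b :
  (forall x, 0 < p x) -> (forall x, 0 < q x) ->
  (forall z, P z = \sum_(x | G x == z) p x) ->
  (forall z, Q z = \sum_(x | G x == z) q x) ->
  1 < zeta -> \sum_x p x * (p x / q x) `^ (zeta - 1) <= expR b ->
  (renyi zeta P Q <= ((zeta - 1)^-1 * b)%:E)%E.
Proof.
move=> p0 q0 PE QE z1 le_b; have s0 : 0 < zeta - 1 by lra.
have P0 z : 0 <= P z by rewrite PE sumr_ge0// => x _; exact: ltW.
rewrite /renyi EFinM lee_pmul2l// ?lte_fin ?invr_gt0//.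
rewrite -[b]expRK -lne_EFin ?expR_gt0//.
(* As [q] is positive, [Q z = 0] only for an empty fiber, where [P z = 0] too; so no infinite term
   survives. *)
have termE z : ((P z)%:E * (if (Q z == 0)%R then +oo
    else ((P z / Q z) `^ (zeta - 1))%R%:E))%E =
    (P z * (P z / Q z) `^ (zeta - 1))%:E.
  case: eqP => // Qz0; suff -> : P z = 0 by rewrite mul0e mul0r.
  rewrite PE big_pred0// => x; apply/negP => Gx.
  have : 0 < Q z.
    rewrite QE (bigD1 x)//= ltr_wpDr// sumr_ge0// => y _; exact: ltW.
  by rewrite Qz0 ltxx.
rewrite lee_lne ?in_itv/= ?leey ?andbT ?lee_fin ?expR_ge0//; last first.
  by apply: esum_ge0 => z _; rewrite termE lee_fin mulr_ge0 ?powR_ge0.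
(* The sum over [Z] is a supremum of finite partial sums, and each point of [X] lies in at most one
   fiber. *)
apply: ge_ereal_sup => _ [A [finA _] <-].
rewrite fsbig_finite//=; under eq_bigr do rewrite termE.
rewrite sumEFin lee_fin; apply: le_trans le_b.
pose r : seq Z := finmap.enum_fset (fset_set A); rewrite -/r.
have le1 : \sum_(z <- r) P z * (P z / Q z) `^ (zeta - 1) <=
    \sum_(z <- r) \sum_(x | G x == z) p x * (p x / q x) `^ (zeta - 1).
  by apply: ler_sum => z _; rewrite PE QE; apply: fiber_moment_le => //; lra.
apply: (le_trans le1).
rewrite (exchange_big_dep xpredT)//=; apply: ler_sum => x _.
have t0 : 0 <= p x * (p x / q x) `^ (zeta - 1).
  by rewrite mulr_ge0 ?powR_ge0// ltW.
rewrite big_const_seq iter_addr_0 -[leRHS]mulr1n ler_wpMn2l//.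
rewrite (eq_count (_ : _ =1 pred1 (G x))); last by move=> z; rewrite /= eq_sym.
by rewrite count_uniq_mem; [exact: leq_b1|exact: finmap.fset_uniq].
Qed.

End Inequalities.

(** * Finite laws and noise-driven algorithms *)

Section Laws.
Variable R : realType.

Section Pushforward.
Variables (X Y : finType) (p : finite_law R X) (f : X -> Y).

Definition push_mass (y : Y) : R := \sum_(x | f x == y) p x.

Lemma push_mass_ge0 y : 0 <= push_mass y.
Proof. by apply: sumr_ge0 => x _; exact: mass_ge0. Qed.

Lemma push_mass_sum1 : \sum_y push_mass y = 1.
Proof.
by rewrite -[RHS](mass_sum1 p) [RHS](partition_big f xpredT)//=.
Qed.

Definition push := FiniteLaw push_mass_ge0 push_mass_sum1.
End Pushforward.

Section Powers.
Variables (I X : finType) (p : finite_law R X).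

Definition pow_mass (f : {ffun I -> X}) : R := \prod_i p (f i).

Lemma pow_mass_ge0 f : 0 <= pow_mass f.
Proof. by apply: prodr_ge0 => i _; exact: mass_ge0. Qed.

Lemma pow_mass_moment (F : I -> X -> R) :
  \sum_(f : {ffun I -> X}) pow_mass f * \prod_i F i (f i) =
  \prod_i \sum_x p x * F i x.
Proof.
by rewrite bigA_distr_bigA; apply: eq_bigr => f _; rewrite -big_split.
Qed.

Lemma pow_mass_sum1 : \sum_f pow_mass f = 1.
Proof.
transitivity (\prod_(i : I) \sum_x p x); first by rewrite bigA_distr_bigA.
by apply: big1 => i _; exact: mass_sum1.
Qed.

Definition pow_law := FiniteLaw pow_mass_ge0 pow_mass_sum1.
End Powers.

Section Products.
Variables (X Y : finType) (p : finite_law R X) (q : finite_law R Y).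

Definition pair_mass (z : X * Y) : R := p z.1 * q z.2.

Lemma pair_mass_ge0 z : 0 <= pair_mass z.
Proof. by rewrite mulr_ge0// mass_ge0. Qed.

Lemma pair_mass_sum1 : \sum_z pair_mass z = 1.
Proof.
rewrite -(pair_bigA _ (fun x y => p x * q y))/= -[RHS](mass_sum1 p).
by apply: eq_bigr => x _; rewrite -mulr_sumr mass_sum1 mulr1.
Qed.

Definition pair_law := FiniteLaw pair_mass_ge0 pair_mass_sum1.
End Products.

Section Uniform.
Variables (X : finType) (X0 : (0 < #|X|)%N).

Lemma uniform_mass_ge0 (x : X) : 0 <= (#|X|%:R^-1 : R).
Proof. by rewrite invr_ge0. Qed.

Lemma uniform_mass_sum1 : \sum_(x : X) (#|X|%:R^-1 : R) = 1.
Proof.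
by rewrite sumr_const -[LHS]mulr_natr mulVf// pnatr_eq0 -lt0n.
Qed.

Definition uniform_law :=
  FiniteLaw uniform_mass_ge0 uniform_mass_sum1.
End Uniform.

Section Probability.
Variables (X : finType) (p : finite_law R X).

Definition prob (E : pred X) : R := \sum_(x | E x) p x.

Lemma prob_le (E F : pred X) : (forall x, E x -> F x) -> prob E <= prob F.
Proof.
move=> EF; rewrite /prob big_mkcond [leRHS]big_mkcond; apply: ler_sum => x _.
by case: ifP => [/EF ->//|_]; case: ifP => // _; exact: mass_ge0.
Qed.

Lemma probC E : prob E = 1 - prob (predC E).
Proof. by rewrite -(mass_sum1 p) (bigID E)/= addrK. Qed.

Lemma prob_union (I : finType) (E : I -> pred X) :
  prob (fun x => [exists i, E i x]) <= \sum_i prob (E i).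
Proof.
rewrite /prob (exchange_big_dep xpredT)//= big_mkcond; apply: ler_sum => x _.
case: ifP => [/existsP[i Ei]|_]; last by apply: sumr_ge0 => i _; exact: mass_ge0.
by rewrite (bigD1 i)//= lerDl sumr_ge0// => j _; exact: mass_ge0.
Qed.

Lemma prob_setU (E F : pred X) : prob (fun x => E x || F x) <= prob E + prob F.
Proof.
rewrite /prob (big_mkcond E) (big_mkcond F) -big_split/= big_mkcond.
apply: ler_sum => x _; have := mass_ge0 p x.
by case: (E x); case: (F x) => /=; lra.
Qed.

Lemma markov_prob (E : pred X) (F : X -> R) a : 0 < a ->
  (forall x, 0 <= F x) -> (forall x, E x -> a <= F x) ->
  prob E <= (\sum_x p x * F x) / a.
Proof.
move=> a0 F0 EF; rewrite ler_pdivlMr// /prob mulr_suml big_mkcond.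
apply: ler_sum => x _; case: ifP => [/EF|_].
  by move=> ?; rewrite ler_wpM2l// mass_ge0.
by rewrite mulr_ge0// mass_ge0.
Qed.

End Probability.

Lemma prob_fst (X Y : finType) (p : finite_law R X) (q : finite_law R Y)
    (E : pred X) : prob (pair_law p q) (fun z => E z.1) = prob p E.
Proof.
rewrite /prob big_mkcond/=.
rewrite -(pair_bigA _ (fun x y => if E x then p x * q y else 0))/=.
rewrite [RHS]big_mkcond; apply: eq_bigr => x _; case: ifP => _.
  by rewrite -mulr_sumr mass_sum1 mulr1.
by rewrite big1.
Qed.

Lemma prob_snd (X Y : finType) (p : finite_law R X) (q : finite_law R Y)
    (E : pred Y) : prob (pair_law p q) (fun z => E z.2) = prob q E.
Proof.
rewrite /prob big_mkcond/=.
rewrite -(pair_bigA _ (fun x y => if E y then p x * q y else 0))/=.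
rewrite exchange_big/= [RHS]big_mkcond; apply: eq_bigr => y _; case: ifP => _.
  by rewrite -mulr_suml mass_sum1 mul1r.
by rewrite big1.
Qed.

End Laws.

(** * Storing a finite state space in memory words *)

Section Encoding.
Variables (S M : finType) (s0 : S).
Hypothesis le_card : (#|S| <= #|M|)%N.

(** States are stored by rank, so the space used depends on the number of states only. *)
Definition encode (s : S) : M := enum_val (widen_ord le_card (enum_rank s)).
Definition decode (m : M) : S := odflt s0 [pick s | encode s == m].

Lemma encodeK : cancel encode decode.
Proof.
move=> s; rewrite /decode; case: pickP => [s' /eqP|/(_ s)]; last by rewrite eqxx.
by move=> /enum_val_inj/(congr1 val)/= /val_inj/enum_rank_inj.
Qed.
End Encoding.

(* [X0] carries the random seed and [X1] the fresh noise of one update, so that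
   the transition [st] itself is deterministic. *)
Section Noise.
Variables (R : realType) (n m w T' : nat).
Let T := T'.+1.
Variables (X0 X1 S : finType) (p0 : finite_law R X0) (p1 : finite_law R X1).
Variables (i0 : X0 -> S) (st : S -> update n -> X1 -> S) (est : S -> R).
Variable le_card : (#|S| <= #|{: memory m w}|)%N.
Variable s0 : S.

Let enc : S -> memory m w := encode le_card.
Let dec : memory m w -> S := decode s0 le_card.

Definition noise_algorithm : streaming_algorithm R n m w :=
  StreamingAlgorithm (push p0 (enc \o i0))
    (fun mu u => push p1 (fun y => enc (st (dec mu) u y)))
    (est \o dec).

Variable x : stream n T.

Fixpoint traj (o : X0) (e : {ffun 'I_T -> X1}) (t : nat) : S :=
  if t is t'.+1 then st (traj o e t') (x (inord t')) (e (inord t')) else i0 o.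

Definition traj_outputs (z : X0 * {ffun 'I_T -> X1}) : {ffun 'I_T -> R} :=
  [ffun t : 'I_T => est (traj z.1 z.2 t.+1)].

Let trun o e : run m w T := [ffun t : 'I_T.+1 => enc (traj o e t)].

Lemma trunP o (e : {ffun 'I_T -> X1}) (s : run m w T) :
  (enc (i0 o) == s ord0) && [forall t : 'I_T,
    enc (st (dec (s (widen_ord (leqnSn T) t))) (x t) (e t)) == s (lift ord0 t)]
  = (s == trun o e).
Proof.
apply/andP/eqP => [[/eqP h0 /forallP hs]|->].
  suff H t : (t < T.+1)%N -> s (inord t) = enc (traj o e t).
    by apply/ffunP => t; rewrite ffunE -H// inord_val.
  elim: t => [_|t IH tT].
    rewrite -[RHS]/(enc (i0 o)) h0; congr (s _).
    by apply: val_inj; rewrite /= inordK.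
  have tT' : (t < T)%N by [].
  have /eqP := hs (Ordinal tT').
  have -> : widen_ord (leqnSn T) (Ordinal tT') = inord t.
    by apply: val_inj; rewrite /= inordK// ltnW.
  have -> : lift ord0 (Ordinal tT') = inord t.+1.
    by apply: val_inj; rewrite /= inordK.
  rewrite IH ?(ltnW tT)// /dec encodeK => <-/=; congr (enc (st _ (x _) (e _)));
  by apply: val_inj; rewrite /= inordK.
split; first by rewrite ffunE.
apply/forallP => t; rewrite !ffunE/= /dec encodeK.
by rewrite /bump/= inord_val.
Qed.

(** Distributing the product of pushforward sums yields a sum over all seeds and noise sequences; by
    [trunP] each of them is compatible with exactly one run. *)
Lemma run_probE (s : run m w T) :
  run_prob noise_algorithm x s =
  \sum_(z : X0 * {ffun 'I_T -> X1} | s == trun z.1 z.2)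
     pair_law p0 (pow_law 'I_T p1) z.
Proof.
rewrite /run_prob/= /push_mass [in X in X * _]big_mkcond/=.
under [in X in _ * X]eq_bigr => t _ do rewrite big_mkcond/=.
rewrite bigA_distr_bigA/= big_distrl/=.
under eq_bigr => o _ do rewrite big_distrr/=.
rewrite pair_bigA/= [RHS]big_mkcond; apply: eq_bigr => -[a e] _ /=.
rewrite -trunP; case: ifP => [h0|_]/=; last by rewrite mul0r.
case: ifPn => [/forallP hs|]; rewrite /pair_mass/= /pow_mass.
  by congr (_ * _); apply: eq_bigr => t _; rewrite hs.
rewrite negb_forall => /existsP[t ht].
by rewrite [X in _ * X](bigD1 t)//= (negbTE ht) mul0r mulr0.
Qed.

(** From here on privacy and accuracy are questions about the product space of seed and noise, with
    no reference to memory. *)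
Lemma output_probE (E : pred {ffun 'I_T -> R}) :
  output_prob noise_algorithm x E =
  prob (pair_law p0 (pow_law 'I_T p1)) (fun z => E (traj_outputs z)).
Proof.
rewrite /output_prob /prob; under eq_bigr do rewrite run_probE.
rewrite (exchange_big_dep xpredT)//= [RHS]big_mkcond/=; apply: eq_bigr => z _.
have oE : outputs noise_algorithm (trun z.1 z.2) = traj_outputs z.
  apply/ffunP => t; by rewrite !ffunE/= /dec encodeK.
case: ifPn => [Ez|Ez].
  rewrite (big_pred1 (trun z.1 z.2))// => s; rewrite /=.
  by case: eqP => [->|]; rewrite ?oE ?Ez// andbF.
rewrite big_pred0// => s; apply/negP => /andP[Es /eqP sE].
by move: Es; rewrite sE oE (negbTE Ez).
Qed.

End Noise.

(** * Noise on a cyclic group *)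

Section CyclicNorm.
Variable M : nat.
Implicit Types y z : 'I_M.+2.

(** The distance to 0 on a cycle; writing its length as [M.+2] gives the ordinals their ring
    structure. *)
Definition znorm z : nat := minn z (M.+2 - z).

Lemma znorm0 : znorm 0 = 0%N.
Proof. by rewrite /znorm min0n. Qed.

Lemma znormN z : znorm (- z) = znorm z.
Proof.
rewrite /znorm/=; have zM := ltn_ord z.
have [->|z0] := posnP z; first by rewrite subn0 modnn.
by rewrite modn_small; lia.
Qed.

Lemma znormD y z : (znorm (y + z)%R <= znorm y + znorm z)%N.
Proof.
rewrite /znorm/=; have yM := ltn_ord y; have zM := ltn_ord z.
have [yz|yz] := ltnP (y + z)%N M.+2; first by rewrite modn_small//; lia.
rewrite -(subnK yz) modnDr modn_small; lia.
Qed.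

Lemma znorm_sum (I : Type) (r : seq I) (P : pred I) (F : I -> 'I_M.+2) :
  (znorm (\sum_(i <- r | P i) F i)%R <= \sum_(i <- r | P i) znorm (F i))%N.
Proof.
elim/big_ind2: _ => [|y1 n1 y2 n2 le1 le2|//]; first by rewrite znorm0.
exact: leq_trans (znormD _ _) (leq_add le1 le2).
Qed.

Lemma znorm_nat k : (k.*2 <= M.+2)%N -> znorm k%:R = k.
Proof.
by move=> kM; rewrite /znorm Zp_nat/= modn_small; lia.
Qed.

Lemma znorm_int (k : int) : (znorm k%:~R <= `|k|)%N.
Proof.
have nat_le n : (znorm n%:R <= n)%N.
  elim: n => [|n IH]; first by rewrite znorm0.
  rewrite -natr1 -addn1 (leq_trans (znormD _ _))// leq_add//.
  by rewrite (@znorm_nat 1).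
by case: k => n; [exact: nat_le|rewrite NegzE mulrNz znormN; exact: nat_le].
Qed.

End CyclicNorm.

Section Noise.
Variables (R : realType) (M : nat) (eps : R).
Hypothesis eps0 : 0 < eps.

Let weight (z : 'I_M.+2) : R := expR (- (eps * (znorm z)%:R)).

Let weight_gt0 z : 0 < weight z. Proof. exact: expR_gt0. Qed.

Let total : R := \sum_z weight z.

Let total_gt0 : 0 < total.
Proof.
rewrite /total (bigD1 ord0)//= ltr_wpDr// sumr_ge0// => z _; exact: ltW.
Qed.

Let noise_mass_ge0 z : 0 <= weight z / total.
Proof. by rewrite divr_ge0// ltW. Qed.

Let noise_mass_sum1 : \sum_z weight z / total = 1.
Proof. by rewrite -mulr_suml divff// gt_eqF. Qed.

Definition noise_law := FiniteLaw noise_mass_ge0 noise_mass_sum1.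

Lemma noise_law_gt0 z : 0 < noise_law z.
Proof. by rewrite /= divr_gt0. Qed.

(** By the triangle inequality a shift by [d] changes the exponent by at most [eps * k]. *)
Lemma noise_law_shift z d k : (znorm d <= k)%N ->
  noise_law z <= expR (k%:R * eps) * noise_law (z + d).
Proof.
move=> dk /=; rewrite mulrA ler_pM2r ?invr_gt0//.
rewrite -expRD ler_expR.
have : (znorm (z + d))%:R <= (znorm z)%:R + k%:R :> R.
  by rewrite -natrD ler_nat (leq_trans (znormD _ _))// leq_add2l.
move: (znorm (z + d))%:R (znorm z)%:R k%:R => u v l h.
have := ler_wpM2l (ltW eps0) h; lra.
Qed.

Lemma noise_law_shiftV z d k : (znorm d <= k)%N ->
  noise_law (z + d) <= expR (k%:R * eps) * noise_law z.
Proof.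
move=> dk; have := @noise_law_shift (z + d) (- d) k.
by rewrite addrK znormN; exact.
Qed.

(** The bound is uniform in [M] and [eps]. With [q = expR (- (eps / 2))] the numerator is at most
    twice the geometric sum of [q], the denominator at least that of [q ^+ 2], and their ratio is at
    most [2 * (1 + q)]. *)
Lemma noise_law_moment :
  \sum_z noise_law z * expR (eps / 2 * (znorm z)%:R) <= 4.
Proof.
set q : R := expR (- (eps / 2)).
have q0 : 0 < q := expR_gt0 _.
have q1 : q < 1 by rewrite expR_lt1 oppr_lt0 divr_gt0.
have wE z : weight z = q ^+ 2 ^+ znorm z.
  by rewrite /weight /q -expRM_natl -expRM_natl; congr expR; field.
have numE : \sum_z noise_law z * expR (eps / 2 * (znorm z)%:R) =
    (\sum_(z : 'I_M.+2) q ^+ znorm z) / total.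
  rewrite mulr_suml; apply: eq_bigr => z _ /=.
  rewrite mulrAC; congr (_ / _); rewrite /weight -expRD /q -expRM_natl.
  by congr expR; field.
rewrite numE ler_pdivrMr//.
pose S1 := \sum_(i < M.+2) q ^+ i; pose S2 := \sum_(i < M.+2) q ^+ 2 ^+ i.
have S10 : 0 <= S1 by apply: sumr_ge0 => i _; rewrite exprn_ge0// ltW.
have le1 : \sum_(z : 'I_M.+2) q ^+ znorm z <= 2 * S1.
  apply: (@le_trans _ _ (\sum_(z : 'I_M.+2) (q ^+ z + q ^+ (M.+2 - z)))).
    apply: ler_sum => z _; rewrite /znorm /minn.
    by case: ifP => _; rewrite ?lerDl ?lerDr exprn_ge0// ltW.
  rewrite big_split/= (_ : 2 * S1 = S1 + S1); last by ring.
  rewrite lerD2l [leRHS](reindex_inj rev_ord_inj)/=; apply: ler_sum => z _.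
  by apply: ler_wiXn2l; rewrite ?ltW//; have := ltn_ord z; lia.
have le2 : S2 <= total.
  apply: ler_sum => z _; rewrite wE; apply: ler_wiXn2l; rewrite ?exprn_ge0 ?ltW//.
    by rewrite exprn_ilt1// ltW.
  exact: geq_minl.
have S12 : S1 * (1 + q ^+ M.+2) = (1 + q) * S2.
  have h1 := subrX1 q M.+2; have h2 := subrX1 (q ^+ 2) M.+2.
  rewrite -/S1 -/S2 in h1 h2.
  have q1' : q - 1 != 0 by rewrite lt_eqF// subr_lt0.
  apply: (mulfI q1'); rewrite mulrA -h1.
  have -> : (q - 1) * ((1 + q) * S2) = (q ^+ 2 - 1) * S2 by ring.
  by rewrite -h2 -!exprM mulnC exprM; ring.
have qM : 0 < q ^+ M.+2 by rewrite exprn_gt0.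
have S20 : 0 <= S2 by apply: sumr_ge0 => i _; rewrite !exprn_ge0// ltW.
by nra.
Qed.

End Noise.

(** * The binary tree *)

Section Dyadic.
Variable V : zmodType.

(* The register of level [l] of the tree: it accumulates [f] over the first
   half of each dyadic interval of length [2 ^ l.+1], starting from [nu], and
   keeps the sum during the second half. *)
Fixpoint register (nu f : nat -> V) (l t : nat) : V :=
  if t is t'.+1 then
    (if (2 ^ l.+1 %| t')%N then nu t' else register nu f l t') +
    (if odd (t' %/ 2 ^ l) then 0 else f t')
  else 0.

Definition block_start (l t : nat) : nat := (t %/ 2 ^ l.+1 * 2 ^ l.+1)%N.

Lemma odd_divn_block q l i : (i < 2 ^ l.+1)%N ->
  odd ((q * 2 ^ l.+1 + i) %/ 2 ^ l) = (2 ^ l <= i)%N.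
Proof.
move=> il; have p0 : (0 < 2 ^ l)%N by rewrite expn_gt0.
rewrite {1}expnSr mulnA -mulnAC divnMDl// oddD oddM andbF/=.
have [ltl|lel] := ltnP i (2 ^ l); first by rewrite divn_small.
have -> : (i %/ 2 ^ l = 1)%N; last by [].
apply/eqP; rewrite eqn_leq leq_divRL// mul1n lel andbT -ltnS ltn_divLR//.
by rewrite -expnS.
Qed.

(** Within a block the reset happens at offset 0 only, and additions stop after [2 ^ l] steps. *)
Lemma register_prefix nu f l q i : (0 < i <= 2 ^ l.+1)%N ->
  register nu f l (q * 2 ^ l.+1 + i) = nu (q * 2 ^ l.+1)%N +
    \sum_(0 <= j < minn i (2 ^ l)) f (q * 2 ^ l.+1 + j)%N.
Proof.
have p0 : (0 < 2 ^ l)%N by rewrite expn_gt0.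
elim: i => [//|i IH] /andP[_ iM]; rewrite addnS /=.
have il : (i < 2 ^ l.+1)%N by [].
have odE := odd_divn_block q il.
have dvE : (2 ^ l.+1 %| q * 2 ^ l.+1 + i)%N = (i == 0)%N.
  by rewrite dvdn_addr ?dvdn_mull// /dvdn modn_small.
rewrite odE dvE; have [i0|i0] := posnP i.
  by rewrite i0 addn0 leqNgt p0/= (minn_idPl p0) big_nat1 addn0.
rewrite IH; last by rewrite i0 ltnW.
case: leqP => li.
  by rewrite addr0 (minn_idPr (leqW li)).
by rewrite (minn_idPl li) big_nat_recr//= addrA.
Qed.

Lemma odd_divn_leq l t : odd (t %/ 2 ^ l) -> (2 ^ l <= t %% 2 ^ l.+1)%N.
Proof.
by rewrite {1}(divn_eq t (2 ^ l.+1)) odd_divn_block// ltn_mod expn_gt0.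
Qed.

Lemma block_end_leq l t : odd (t %/ 2 ^ l) -> (block_start l t + 2 ^ l <= t)%N.
Proof.
by move=> /odd_divn_leq ot; rewrite [leqRHS](divn_eq t (2 ^ l.+1)) leq_add2l.
Qed.

(** Bit [l] of [t] is set exactly when [t] is in the second half of its block, and then the first
    half has been summed completely. *)
Lemma register_odd nu f l t : odd (t %/ 2 ^ l) ->
  register nu f l t = nu (block_start l t) +
    \sum_(block_start l t <= i < block_start l t + 2 ^ l) f i.
Proof.
move=> /odd_divn_leq rl; have p0 : (0 < 2 ^ l)%N by rewrite expn_gt0.
have p1 : (0 < 2 ^ l.+1)%N by rewrite expn_gt0.
rewrite {1}(divn_eq t (2 ^ l.+1)) register_prefix; last first.
  by rewrite (leq_trans p0 rl) ltnW// ltn_mod.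
rewrite (minn_idPr rl) -/(block_start l t); congr (_ + _).
rewrite -{2}[block_start l t]add0n big_addn addKn.
by apply: eq_bigr => i _; rewrite addnC.
Qed.

Lemma sum_registers_odd (nu : nat -> nat -> V) f L t : (t < 2 ^ L)%N ->
  \sum_(l < L | odd (t %/ 2 ^ l)) register (nu l) f l t =
  \sum_(l < L | odd (t %/ 2 ^ l)) nu l (block_start l t) +
  \sum_(0 <= i < t) f i.
Proof.
move=> tL.
rewrite (eq_bigr (fun l : 'I_L => nu l (block_start l t) +
    \sum_(block_start l t <= i < block_start l t + 2 ^ l) f i)); last first.
  by move=> l; exact: register_odd.
rewrite big_split/=; congr (_ + _).
pose S m := \sum_(0 <= i < m) f i.
(* The half blocks of the set bits tile the interval from 0 to [t]: clearing the low bits of [t] one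
   by one gives their end points, so the sum telescopes. A clear bit contributes 0. *)
transitivity (\sum_(0 <= l < L)
    (S (t %/ 2 ^ l * 2 ^ l)%N - S (t %/ 2 ^ l.+1 * 2 ^ l.+1)%N)).
  rewrite big_mkord big_mkcond; apply: eq_bigr => l _.
  have eqt : (t %/ 2 ^ l * 2 ^ l = block_start l t + odd (t %/ 2 ^ l) * 2 ^ l)%N.
    rewrite /block_start expnSr divnMA divn2 mulnA (mulnAC _ (2 ^ l)%N) -mulnDl.
    by rewrite -{1}(odd_double_half (t %/ 2 ^ l)) addnC muln2.
  rewrite eqt -/(block_start l t); case: odd; last first.
    by rewrite mul0n addn0 subrr.
  rewrite mul1n /S (@big_cat_nat _ _ _ (block_start l t) 0)//= ?leq_addr//.
  by rewrite addrAC subrr add0r.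
rewrite -[RHS]/(S t).
have tele g : \sum_(0 <= l < L) (g l - g l.+1) = g 0%N - g L :> V.
  elim: L {tL} => [|L IH]; first by rewrite big_geq// subrr.
  by rewrite big_nat_recr//= IH addrA subrK.
rewrite (tele (fun l => S (t %/ 2 ^ l * 2 ^ l)%N)) expn0 divn1 muln1.
by rewrite divn_small// mul0n /S [X in _ - X]big_geq// subr0.
Qed.

End Dyadic.

(** * Pairwise independent levels *)

Lemma card_ord_interval (m a b : nat) : (a <= b)%N -> (b <= m)%N ->
  #|[pred i : 'I_m | a <= i < b]%N| = (b - a)%N.
Proof.
move=> ab bm; rewrite -sum1_card -[RHS]muln1 -sum_nat_const_nat.
rewrite (big_nat_widen a b m)// (big_nat_widenl a 0)//= big_mkord.
by apply: eq_bigl => i; rewrite inE andbC.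
Qed.

Section PairwiseHash.
Local Open Scope nat_scope.

(** The level is read off the leading bit of [r], so level [k] receives a fraction [2 ^- k.+1] of
    the values below [2 ^ K]; the value 0 is sent to [K], beyond all tracked levels. *)
Definition hash_level (K r : nat) : nat :=
  if r == 0 then K else K.-1 - trunc_log 2 r.

Lemma hash_levelP K r k : k < K -> r < 2 ^ K ->
  (hash_level K r == k) = (2 ^ (K - k.+1) <= r < 2 ^ (K - k)).
Proof.
move=> kK rK; rewrite /hash_level; case: posnP => [->|r0].
  by rewrite gtn_eqF// leqNgt expn_gt0.
have Kk : K - k = (K - k.+1).+1 by lia.
have tK : trunc_log 2 r < K.
  by rewrite -(@ltn_exp2l 2)// (leq_ltn_trans _ rK)// trunc_logP.
apply/eqP/idP => [lk|bnd].
  have -> : K - k.+1 = trunc_log 2 r by lia.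
  have -> : K - k = (trunc_log 2 r).+1 by lia.
  by rewrite trunc_logP// trunc_log_ltn.
rewrite (@trunc_log_eq 2 (K - k.+1)) -?Kk//; lia.
Qed.

Lemma card_hash_level (F : finType) K k : #|F| = 2 ^ K -> k < K ->
  #|[pred f : F | hash_level K (enum_rank f) == k]| * 2 ^ k.+1 = 2 ^ K.
Proof.
move=> cF kK.
have -> : #|[pred f : F | hash_level K (enum_rank f) == k]| =
    #|[pred i : 'I_#|F| | 2 ^ (K - k.+1) <= i < 2 ^ (K - k)]|.
  rewrite -[LHS](fintype.card_image (@enum_rank_inj F)); apply: eq_card => i.
  have iK : i < 2 ^ K by rewrite -[X in _ < X]cF.
  rewrite -[i in LHS]enum_valK (fintype.mem_image (@enum_rank_inj F)) !inE enum_valK.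
  exact: hash_levelP.
rewrite card_ord_interval ?cF ?leq_exp2l ?leq_subr//; last by lia.
have -> : K - k = (K - k.+1).+1 by lia.
rewrite expnS mul2n -addnn addnK -expnD; congr (2 ^ _); lia.
Qed.

(** The hash functions are the affine maps over the field with [2 ^ K] elements, followed by
    [hash_level]. *)
Lemma pairwise_hash K : 0 < K ->
  exists (Om : finType) (h : Om -> 'I_(2 ^ K) -> nat),
  [/\ #|Om| = 2 ^ K * 2 ^ K,
      forall k i, k < K -> #|[pred o | h o i == k]| * 2 ^ k.+1 = #|Om|
    & forall k i j, k < K -> i != j ->
      #|[pred o | (h o i == k) && (h o j == k)]| * (2 ^ k.+1 * 2 ^ k.+1) = #|Om|].
Proof.
move=> K0; have [F _ cF] := finfield.PrimePowerField (isT : prime 2) K0.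
pose lev (f : F) := hash_level K (enum_rank f).
pose el (i : 'I_(2 ^ K)) : F := enum_val (cast_ord (esym cF) i).
pose h (o : F * F) i := lev (o.1 * el i + o.2)%R.
have el_inj : injective el by move=> i j /enum_val_inj/cast_ord_inj.
have cOm : #|{: F * F}| = 2 ^ K * 2 ^ K by rewrite card_prod cF.
exists (F * F)%type, h; split=> // k i.
  move=> kK; rewrite -[X in X * _]sum1_card cOm.
  under eq_bigl do rewrite inE.
  rewrite -(pair_big_dep xpredT (fun a b => lev (a * el i + b)%R == k)
    (fun _ _ => 1))/=.
  rewrite (eq_bigr (fun=> #|[pred f : F | lev f == k]|)).
    by rewrite sum_nat_const cF -mulnA card_hash_level.
  by move=> a _; rewrite -[RHS]sum1_card [RHS](reindex_inj (addrI (a * el i)%R)).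
move=> j kK ij; rewrite cOm.
(* Evaluating an affine map at two distinct points is a bijection of [F * F], hence the two values
   are independent. *)
pose phi (o : F * F) := (o.1 * el i + o.2, o.1 * el j + o.2)%R.
have phi_inj : injective phi.
  move=> [a b] [c d] [/= e1 e2].
  have e : ((a - c) * (el i - el j) = 0)%R.
    have -> : ((a - c) * (el i - el j) = (a * el i + b - (a * el j + b))
      - (c * el i + d - (c * el j + d)))%R by ring.
    by rewrite e1 e2 subrr.
  have ac : a = c.
    apply/eqP; rewrite -subr_eq0; move/eqP: e; rewrite mulf_eq0 => /orP[//|].
    by rewrite (subr_eq0 (el i)) (inj_eq el_inj) (negbTE ij).
  by move: e1; rewrite ac => /addrI ->.
transitivity (#|[pred o : F * F | (lev o.1 == k) && (lev o.2 == k)]| *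
    (2 ^ k.+1 * 2 ^ k.+1)).
  congr (_ * _); rewrite -[RHS]sum1_card [RHS](reindex_inj phi_inj).
  by rewrite -[LHS]sum1_card; apply: eq_bigl => a; rewrite !inE.
have -> : #|[pred o : F * F | (lev o.1 == k) && (lev o.2 == k)]| =
    #|[pred f : F | lev f == k]| * #|[pred f : F | lev f == k]|.
  by rewrite -cardX; apply: eq_card => -[u v]; rewrite !inE.
by rewrite mulnACA !card_hash_level.
Qed.

End PairwiseHash.

(** * The sketch and its privacy *)

Section Sketch.
Variables (R : realType) (K N L M T' : nat) (Om : finType).
Let T := T'.+1.
Let n := (2 ^ K)%N.
Variable h : Om -> 'I_n -> nat.

Definition cell := ('I_N * 'I_K * 'I_L)%type.
Definition seeds := {ffun 'I_N -> Om}.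
Definition registers := {ffun cell -> 'I_M.+2}.
Definition sketch_state := (seeds * 'I_T.+1 * registers)%type.

Definition contribution (o : Om) (k : nat) (u : update n) : 'I_M.+2 :=
  if h o u.1 == k then (ssval u.2)%:~R else 0.

Definition sketch_init (o : seeds) : sketch_state := (o, ord0, [ffun=> 0]).

(** This advances every [register] at once. Fresh noise is drawn for all cells, and a cell takes it
    in when its block starts. *)
Definition sketch_step (s : sketch_state) (u : update n) (nu : registers) :
    sketch_state :=
  (s.1.1, inord s.1.2.+1,
   [ffun j : cell => (if (2 ^ j.2.+1 %| s.1.2)%N then nu j else s.2 j) +
      (if odd (s.1.2 %/ 2 ^ j.2) then 0
       else contribution (s.1.1 j.1.1) j.1.2 u)]).

Definition sketch_read (s : sketch_state) (r : 'I_N) (k : 'I_K) : 'I_M.+2 :=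
  \sum_(l < L | odd (s.1.2 %/ 2 ^ l)) s.2 (r, k, l).

(** A level counts if a strict majority of the seeds exceeds the threshold; if no level does, the
    empty maximum returns 0. *)
Definition sketch_estimate (thr : nat) (s : sketch_state) : R :=
  (\max_(k < K | (N < 2 * #|[pred r | (thr < znorm (sketch_read s r k))%N]|)%N)
     2 ^ k)%:R.

Definition cell_noise (e : {ffun 'I_T -> registers}) (r : 'I_N) (k : 'I_K)
  (l : 'I_L) (t : nat) : 'I_M.+2 := e (inord t) (r, k, l).

Definition arrivals (x : stream n T) (o : Om) (k t : nat) : 'I_M.+2 :=
  contribution o k (x (inord t)).

Lemma traj_sketch x (o : seeds) e t : (t <= T)%N ->
  traj sketch_init sketch_step x o e t =
  (o, inord t, [ffun j : cell =>
     register (cell_noise e j.1.1 j.1.2 j.2) (arrivals x (o j.1.1) j.1.2) j.2 t]).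
Proof.
elim: t => [_|t IH tT].
  by congr (_, _, _); apply: val_inj; rewrite /= inordK.
rewrite /= IH ?(ltnW tT)// /sketch_step/= inordK ?ltnS ?(ltnW tT)//.
congr (_, _, _); apply/ffunP => -[[r k] l]; rewrite !ffunE/=.
by [].
Qed.

Lemma sketch_readE x o e t r k : (t <= T)%N ->
  sketch_read (traj sketch_init sketch_step x o e t) r k =
  \sum_(l < L | odd (t %/ 2 ^ l))
    register (cell_noise e r k l) (arrivals x (o r) k) l t.
Proof.
move=> tT; rewrite traj_sketch// /sketch_read/= inordK ?ltnS//.
by apply: eq_bigr => l _; rewrite ffunE.
Qed.

Lemma sketch_read_prefix x o e t r k : (t <= T)%N -> (T < 2 ^ L)%N ->
  sketch_read (traj sketch_init sketch_step x o e t) r k =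
  \sum_(l < L | odd (t %/ 2 ^ l)) cell_noise e r k l (block_start l t) +
  \sum_(0 <= i < t) arrivals x (o r) k i.
Proof.
move=> tT TL; rewrite sketch_readE//.
(* The tree lemma indexes its levels by all naturals, so the noise is extended by 0 beyond [L]. *)
pose nu (l : nat) := if insub l is Some l' then cell_noise e r k l' else fun=> 0.
have nuE (l : 'I_L) : nu l = cell_noise e r k l by rewrite /nu valK.
transitivity (\sum_(l < L | odd (t %/ 2 ^ l))
    register (nu l) (arrivals x (o r) k) l t).
  by apply: eq_bigr => l _; rewrite nuE.
rewrite sum_registers_odd ?(leq_ltn_trans tT)//; congr (_ + _).
by apply: eq_bigr => l _; rewrite nuE.
Qed.

Lemma znorm_contribution o k u : (znorm (contribution o k u) <= 1)%N.
Proof.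
rewrite /contribution; case: ifP => _; last by rewrite znorm0.
apply: leq_trans (znorm_int _ _) _.
by have := valP u.2; rewrite !inE => /or3P[] /eqP ->.
Qed.

(** * Coupling the noise on neighboring streams *)

Section Privacy.
Variables (x x' : stream n T) (i : 'I_T).
Hypothesis x_x' : forall t, t != i -> x t = x' t.

(* The output only reads registers whose block is complete, so the change of the
   update at time [i] can be absorbed by the noise at the start of these blocks. *)
Definition noise_shift (o : seeds) (t : nat) (j : cell) : 'I_M.+2 :=
  if (t == block_start j.2 i) && (i < t + 2 ^ j.2)%N then
    contribution (o j.1.1) j.1.2 (x i) - contribution (o j.1.1) j.1.2 (x' i)
  else 0.

Definition shift_noise (o : seeds) (e : {ffun 'I_T -> registers}) :
    {ffun 'I_T -> registers} :=
  [ffun t : 'I_T => [ffun j => e t j + noise_shift o t j]].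

Lemma shift_noise_inj o : injective (shift_noise o).
Proof.
move=> e e' /ffunP ee; apply/ffunP => t; apply/ffunP => j.
by have := ee t; rewrite !ffunE => /ffunP/(_ j); rewrite !ffunE => /addIr.
Qed.

(** If [i] lies in the summed half block, the noise shift equals the change of the summand at [i];
    otherwise neither the sum nor the noise changes. *)
Lemma register_shift (o : seeds) e r k (l : 'I_L) t :
  (t <= T)%N -> odd (t %/ 2 ^ l) ->
  register (cell_noise e r k l) (arrivals x (o r) k) l t =
  register (cell_noise (shift_noise o e) r k l) (arrivals x' (o r) k) l t.
Proof.
move=> tT ot; rewrite !register_odd//; set b := block_start l t.
have bt : (b + 2 ^ l <= t)%N := block_end_leq ot.
have p0 : (0 < 2 ^ l)%N by rewrite expn_gt0.
have bT : (b < T)%N.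
  by rewrite (leq_trans _ tT)// (leq_trans _ bt)// -addn1 leq_add2l.
rewrite /cell_noise !ffunE -addrA inordK//; congr (_ + _).
rewrite /noise_shift/=.
have -> : (b == block_start l i) && (i < b + 2 ^ l)%N = (b <= i < b + 2 ^ l)%N.
  case ib : (i < b + 2 ^ l)%N; last by rewrite !andbF.
  rewrite !andbT /b /block_start eqn_pmul2r ?expn_gt0//.
  rewrite -leq_divRL ?expn_gt0// eqn_leq andbC.
  have -> : (i %/ 2 ^ l.+1 <= t %/ 2 ^ l.+1)%N; last by [].
  by apply: leq_div2r; apply: ltnW; apply: leq_trans bt.
have far m : (b <= m < b + 2 ^ l)%N -> m != i ->
    arrivals x (o r) k m = arrivals x' (o r) k m.
  move=> /andP[_ mb] mi; rewrite /arrivals x_x'//.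
  apply: contra mi => /eqP <-; rewrite inordK//.
  by rewrite (leq_trans mb)// (leq_trans bt).
case: ifPn => [bib|bib].
  have iI : (nat_of_ord i) \in index_iota b (b + 2 ^ l) by rewrite mem_index_iota.
  rewrite !(bigD1_seq (nat_of_ord i))//= ?iota_uniq// addrA; congr (_ + _).
    by rewrite /arrivals inord_val subrK.
  rewrite [LHS]big_seq_cond [RHS]big_seq_cond; apply: eq_bigr => m.
  by rewrite mem_index_iota => /andP[]; exact: far.
rewrite add0r; apply: eq_big_nat => m bm; apply: far => //.
by apply: contraNneq bib => <-.
Qed.

(** The coupling: for fixed seeds, shifted noise on [x'] reproduces the outputs on [x] exactly. *)
Lemma traj_outputs_shift thr o e :
  traj_outputs sketch_init sketch_step (sketch_estimate thr) x (o, e) =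
  traj_outputs sketch_init sketch_step (sketch_estimate thr) x'
    (o, shift_noise o e).
Proof.
apply/ffunP => t; rewrite !ffunE /sketch_estimate; congr (_%:R).
apply: eq_bigl => k; congr (_ < 2 * _)%N; apply: eq_card => r.
rewrite !inE !sketch_readE ?ltn_ord//; congr (_ < znorm _)%N.
by apply: eq_bigr => l; apply: register_shift; exact: ltn_ord.
Qed.

(** A superset of the places where the noise moves: the levels hit by the old or by the new update,
    at the start of the block containing [i]. *)
Definition shifted_cell (o : seeds) (t : nat) (j : cell) : bool :=
  (t == block_start j.2 i) &&
  ((h (o j.1.1) (x i).1 == j.1.2) || (h (o j.1.1) (x' i).1 == j.1.2)).

Lemma noise_shift0 o t j : ~~ shifted_cell o t j -> noise_shift o t j = 0.
Proof.
rewrite /shifted_cell /noise_shift /contribution; case: (t == _) => //=.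
rewrite negb_or => /andP[/negbTE -> /negbTE ->]; rewrite subrr.
by case: ifP.
Qed.

Lemma znorm_noise_shift o t j : (znorm (noise_shift o t j) <= 2)%N.
Proof.
rewrite /noise_shift; case: ifP => _; last by rewrite znorm0.
apply: leq_trans (znormD _ _) _; rewrite znormN.
exact: (leq_add (znorm_contribution _ _ _) (znorm_contribution _ _ _)).
Qed.

(** For each seed and each tree level there is one block start, and at most two hash levels are
    affected. *)
Lemma sum_shifted_cell o :
  (\sum_(t < T) \sum_(j : cell) shifted_cell o t j <= 2 * N * L)%N.
Proof.
rewrite exchange_big/=.
have one (m : nat) : (\sum_(k < K) (m == k) <= 1)%N.
  have [mK|Km] := ltnP m K.
    rewrite (bigD1 (Ordinal mK))//= eqxx big1 ?addn0// => k.
    by rewrite -val_eqE/= eq_sym => /negbTE ->.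
  by rewrite big1// => k _; rewrite gtn_eqF// (leq_trans (ltn_ord k)).
apply: (@leq_trans (\sum_(r < N) \sum_(k < K) \sum_(l < L)
    ((h (o r) (x i).1 == k) + (h (o r) (x' i).1 == k)))%N).
  rewrite [leqRHS]pair_bigA/= [leqRHS]pair_bigA/=; apply: leq_sum => -[[r k] l] _.
  rewrite /shifted_cell/=; set u := (_ == _); set v := (_ == _).
  apply: (@leq_trans (\sum_(t < T) (block_start l i == t) * (u + v))%N).
    by apply: leq_sum => t _; rewrite eq_sym; case: (_ == _); case: u; case: v.
  rewrite -big_distrl/= -[leqRHS]mul1n leq_mul2r; apply/orP; right.
  have [bT|Tb] := ltnP (block_start l i) T.
    rewrite (bigD1 (Ordinal bT))//= eqxx big1 ?addn0// => t.
    by rewrite -val_eqE/= eq_sym => /negbTE ->.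
  by rewrite big1// => t _; rewrite gtn_eqF// (leq_trans (ltn_ord t)).
apply: (@leq_trans (\sum_(r < N) \sum_(l < L) 2)%N).
  apply: leq_sum => r _; rewrite exchange_big/=; apply: leq_sum => l _.
  by rewrite big_split/= (leq_add (one _) (one _)).
by rewrite !sum_nat_const !card_ord; lia.
Qed.

End Privacy.

Hypothesis Om0 : (0 < #|Om|)%N.
Variable eps : R.
Hypothesis eps0 : 0 < eps.

Definition seeds_law : finite_law R seeds := pow_law 'I_N (uniform_law R Om0).
Definition fresh_law : finite_law R registers :=
  pow_law cell (noise_law M eps).

Let p := pair_law seeds_law (pow_law 'I_T fresh_law).

Lemma sketch_law_gt0 z : 0 < p z.
Proof.
rewrite mulr_gt0//; apply: prodr_gt0 => t _.
  by rewrite /= invr_gt0 ltr0n.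
by apply: prodr_gt0 => j _; exact: noise_law_gt0.
Qed.

Lemma noise_moment (F : 'I_T -> cell -> 'I_M.+2 -> R) :
  \sum_e pow_law 'I_T fresh_law e * \prod_t \prod_j F t j (e t j) =
  \prod_t \prod_j \sum_z noise_law M eps z * F t j z.
Proof.
rewrite (pow_mass_moment fresh_law (fun t nu => \prod_j F t j (nu j))).
by apply: eq_bigr => t _; rewrite -pow_mass_moment.
Qed.

Section Divergence.
Variables (x x' : stream n T) (i : 'I_T) (zeta : R).
Hypothesis z1 : 1 < zeta.

Let shift z := (z.1, shift_noise x x' i z.1 z.2).

(** Given the seeds, the moment factors over the cells. A shifted cell moves by at most 2 units, so
    it costs [2 * (2 * eps) ^+ 2]; with at most [2 * N * L] such cells this makes 16. The seeds are
    left fixed by the coupling. *)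
Lemma shifted_moment_le :
  \sum_z p z * (p z / p (shift z)) `^ (zeta - 1) <=
  expR (16 * (N * L)%:R * eps ^+ 2 * (zeta * (zeta - 1))).
Proof.
set B := expR _; pose q := noise_law M eps.
pose d (o : seeds) (t : 'I_T) j := noise_shift x x' i o t j.
pose c : R := expR (2 * (2%:R * eps) ^+ 2 * (zeta * (zeta - 1))).
have c1 : 1 <= c.
  rewrite -expR0 ler_expR mulr_ge0//; first by rewrite mulr_ge0 ?sqr_ge0.
  by rewrite mulr_ge0 ?subr_ge0 ?(ltW z1)// ltW// (lt_trans _ z1).
have cell_le o t j : \sum_z q z * (q z / q (z + d o t j)) `^ (zeta - 1) <=
    c ^+ shifted_cell x x' i o t j.
  case: (boolP (shifted_cell x x' i o t j)) => [_|H]; last first.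
    rewrite expr0 -(mass_sum1 q); apply: ler_sum => z _.
    rewrite /d noise_shift0// addr0 divff ?powR1 ?mulr1//.
    by rewrite gt_eqF// noise_law_gt0.
  rewrite expr1; apply: ratio_moment_le => //.
  - exact: noise_law_gt0.
  - by move=> z; exact: noise_law_gt0.
  - exact: mass_sum1.
  - rewrite -(mass_sum1 q) [RHS](reindex_inj (addIr (d o t j)))/=.
    by [].
  - by rewrite mulr_ge0// ltW.
  - by move=> z; apply: noise_law_shift => //; exact: znorm_noise_shift.
  - by move=> z; apply: noise_law_shiftV => //; exact: znorm_noise_shift.
have seed_le o : \sum_e pow_law 'I_T fresh_law e *
    (pow_law 'I_T fresh_law e / pow_law 'I_T fresh_law (shift_noise x x' i o e))
      `^ (zeta - 1) <= B.
  have E e : (pow_law 'I_T fresh_law e /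
      pow_law 'I_T fresh_law (shift_noise x x' i o e)) `^ (zeta - 1) =
      \prod_t \prod_j (q (e t j) / q (e t j + d o t j)) `^ (zeta - 1).
    rewrite /= /pow_mass/= /pow_mass -prodf_div.
    rewrite powR_prod; last first.
      by move=> t; rewrite divr_ge0// prodr_ge0// => j _; exact: mass_ge0.
    apply: eq_bigr => t _; rewrite -prodf_div powR_prod; last first.
      by move=> j; rewrite divr_ge0// mass_ge0.
    by apply: eq_bigr => j _; rewrite !ffunE.
  under eq_bigr do rewrite E.
  rewrite (noise_moment (fun t j z => (q z / q (z + d o t j)) `^ (zeta - 1))).
  have pos t j : 0 <= \sum_z q z * (q z / q (z + d o t j)) `^ (zeta - 1).
    by apply: sumr_ge0 => z _; rewrite mulr_ge0 ?powR_ge0 ?mass_ge0.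
  apply: (@le_trans _ _ (\prod_(t < T) \prod_j c ^+ shifted_cell x x' i o t j)).
    apply: ler_prod => t _; apply/andP; split.
      by apply: prodr_ge0 => j _; exact: pos.
    by apply: ler_prod => j _; rewrite pos cell_le.
  under eq_bigr do rewrite prodrXr.
  rewrite prodrXr; apply: (@le_trans _ _ (c ^+ (2 * N * L))).
    by apply: ler_weXn2l => //; exact: sum_shifted_cell.
  rewrite -expRM_natl ler_expR -mulnA natrM le_eqVlt; apply/orP; left.
  by apply/eqP; ring.
rewrite -(pair_bigA _ (fun o e => p (o, e) * (p (o, e) / p (shift (o, e)))
  `^ (zeta - 1))).
have -> : B = \sum_o seeds_law o * B by rewrite -mulr_suml mass_sum1 mul1r.
apply: ler_sum => o _.
apply: le_trans (ler_wpM2l (mass_ge0 _ o) (seed_le o)).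
rewrite mulr_sumr; apply: ler_sum => e _.
have so0 : seeds_law o != 0.
  by rewrite gt_eqF//; apply: prodr_gt0 => t _; rewrite /= invr_gt0 ltr0n.
have pE e' : p (o, e') = seeds_law o * pow_law 'I_T fresh_law e' by [].
by rewrite [shift _]/= !pE -mulf_div divff// mul1r mulrA.
Qed.

End Divergence.

Section Algorithm.
Variables (m w thr : nat) (s0 : sketch_state).
Hypothesis le_card : (#|{: sketch_state}| <= #|{: memory m w}|)%N.

Definition sketch_algorithm : streaming_algorithm R n m w :=
  noise_algorithm seeds_law fresh_law sketch_init sketch_step
    (sketch_estimate thr) le_card s0.

(** Changing variables along the bijection [shift] turns the output law on [x'] into the image of
    the shifted noise law under the output map of [x]. Both laws are then images under one map, and
    data processing applies. *)
Lemma sketch_zCDP rho : 16 * (N * L)%:R * eps ^+ 2 <= rho ->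
  zCDP T sketch_algorithm rho.
Proof.
move=> le_rho x x' /mem_card1[i iP] zeta z1.
have x_x' t : t != i -> x t = x' t.
  by move=> ti; have := iP t; rewrite !inE (negbTE ti) => /negbFE/eqP.
pose shift z := (z.1, shift_noise x x' i z.1 z.2).
have shift_inj : injective shift.
  by move=> [a e] [a' e'] [<- /shift_noise_inj <-].
pose b := 16 * (N * L)%:R * eps ^+ 2 * (zeta * (zeta - 1)).
apply: (@le_trans _ _ ((zeta - 1)^-1 * b)%:E).
  apply: (@renyi_pushforward_le R _ _ p (fun z => p (shift z))
    (traj_outputs sketch_init sketch_step (sketch_estimate thr) x)) => //.
  - exact: sketch_law_gt0.
  - by move=> z; exact: sketch_law_gt0.
  - by move=> z; rewrite /output_law output_probE.
  - move=> z; rewrite /output_law output_probE /prob (reindex_inj shift_inj)/=.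
    apply: eq_bigl => -[a e]; rewrite /shift/=.
    by rewrite -(traj_outputs_shift x_x').
  - exact: shifted_moment_le.
rewrite lee_fin mulrC /b mulrA mulfK; last by rewrite gt_eqF// subr_gt0.
by rewrite ler_pM2r// (lt_trans _ z1).
Qed.

End Algorithm.
End Sketch.

(** * Accuracy *)

Section Accuracy.
Variables (R : realType) (K N L M T' : nat) (Om : finType).
Let T := T'.+1.
Let n := (2 ^ K)%N.
Variable h : Om -> 'I_n -> nat.
Variable x : stream n T.
Hypothesis strict : strict_turnstile x.

Definition hash_count (o : Om) (k : nat) (t : 'I_T) : nat :=
  #|[pred j | (freq x t j != 0) && (h o j == k)]|.

Definition hash_freq (o : Om) (k : nat) (t : 'I_T) : int :=
  \sum_(j | h o j == k) freq x t j.

Lemma hash_freqE o k t : hash_freq o k t =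
  \sum_(i < T | (i <= t)%N && (h o (x i).1 == k)) ssval (x i).2.
Proof.
rewrite /hash_freq /freq.
rewrite (exchange_big_dep (fun i : 'I_T => (i <= t)%N && (h o (x i).1 == k)))/=;
  last by move=> j i /eqP <- /andP[-> /eqP ->]; rewrite eqxx.
apply: eq_bigr => i /andP[it hk]; rewrite (big_pred1 (x i).1)// => j /=.
by rewrite it/= (eq_sym j); case: ((x i).1 =P j) => [<-|_]; rewrite ?hk ?andbF.
Qed.

Lemma sum_arrivals o k (t : 'I_T) :
  \sum_(0 <= i < t.+1) arrivals M h x o k i = (hash_freq o k t)%:~R.
Proof.
rewrite (big_nat_widen _ _ T)//= big_mkord hash_freqE rmorph_sum/=.
rewrite big_mkcondr/=; apply: eq_bigr => i _.
by rewrite /arrivals inord_val /contribution.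
Qed.

Lemma hash_freq_le o k t : hash_freq o k t <= T%:Z.
Proof.
have -> : T%:Z = \sum_(i < T) 1 by rewrite sumr_const card_ord natz.
rewrite hash_freqE big_mkcond; apply: ler_sum => i _.
by case: ifP => // _; have := valP (x i).2; rewrite !inE => /or3P[] /eqP ->.
Qed.

(** Strictness enters here: each present element has frequency at least 1 and nothing cancels. *)
Lemma hash_count_le o k t : (hash_count o k t)%:Z <= hash_freq o k t.
Proof.
rewrite /hash_count -sum1_card /hash_freq.
rewrite -natz natr_sum big_mkcond/= [leRHS]big_mkcond/=; apply: ler_sum => j _.
rewrite inE; have := strict t j; case: (h o j == k); rewrite ?andbF//= andbT.
by case: eqP => [->//|/eqP f0]; rewrite le0r (negbTE f0)/= => f1; lia.
Qed.

Lemma hash_freq0 o k t : hash_count o k t = 0%N -> hash_freq o k t = 0.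
Proof.
move=> c0; apply: big1 => j hk; apply/eqP/negPn/negP => f0.
by have := card0_eq c0 j; rewrite inE f0 hk.
Qed.

Definition noise_size (e : {ffun 'I_T -> registers K N L M}) r k t : nat :=
  \sum_(l < L | odd (t %/ 2 ^ l)) znorm (cell_noise e r k l (block_start l t)).

Hypothesis TL : (T < 2 ^ L)%N.
Hypothesis TM : (T.*2 <= M.+2)%N.

Let state (o : seeds N Om) (e : {ffun 'I_T -> registers K N L M}) :=
  traj (sketch_init K L M T' (Om := Om)) (sketch_step h) x o e.

Implicit Types e : {ffun 'I_T -> registers K N L M}.

Lemma sketch_read_noise (o : seeds N Om) e r k (t : 'I_T) :
  exists2 z : 'I_M.+2, (znorm z <= noise_size e r k t.+1)%N &
    sketch_read (state o e t.+1) r k = z + (hash_freq (o r) k t)%:~R.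
Proof.
exists (\sum_(l < L | odd (t.+1 %/ 2 ^ l))
    cell_noise e r k l (block_start l t.+1)); first exact: znorm_sum.
by rewrite sketch_read_prefix ?ltn_ord// sum_arrivals.
Qed.

Lemma znorm_read_le (o : seeds N Om) e r k (t : 'I_T) thr :
  (noise_size e r k t.+1 <= thr)%N ->
  hash_count (o r) k t = 0%N -> (znorm (sketch_read (state o e t.+1) r k) <= thr)%N.
Proof.
move=> le_thr c0; have [z zn ->] := sketch_read_noise o e r k t.
by rewrite hash_freq0// addr0 (leq_trans zn).
Qed.

Lemma znorm_read_gt (o : seeds N Om) e r k (t : 'I_T) thr :
  (noise_size e r k t.+1 <= thr)%N ->
  (2 * thr < hash_count (o r) k t)%N ->
  (thr < znorm (sketch_read (state o e t.+1) r k))%N.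
Proof.
move=> le_thr gt_thr; have [z zn ->] := sketch_read_noise o e r k t.
have := hash_count_le (o r) k t; have := hash_freq_le (o r) k t.
case: (hash_freq _ _ _) => [f|f] fT cf; last by lia.
have : (znorm (f%:R : 'I_M.+2) <= znorm (z + f%:R)%R + znorm z)%N.
  by rewrite -{1}(addKr z f%:R) addrC (leq_trans (znormD _ _))// znormN.
(* The true total is at most [T], and the cycle has length at least [2 * T], so the total does not
   wrap around. *)
rewrite znorm_nat; last by lia.
rewrite -[(Posz f)%:~R]/(f%:R); move: (znorm _) (znorm _) zn => u v zn H.
by lia.
Qed.

Variables (tau thr : nat).
Hypothesis tau_thr : (2 * thr < tau)%N.

(** The mean of [hash_count] is [distinct x t / 2 ^ k.+1]. A seed is bad if this mean is at most
    [1 / 16] but an element arrives, or at least [2 * tau] but fewer than [tau] elements arrive. *)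
Definition bad_hash (o : Om) (k : nat) (t : 'I_T) : bool :=
  ((16 * distinct x t <= 2 ^ k.+1) && (0 < hash_count o k t) ||
   (tau * 2 ^ k.+2 <= distinct x t) && (hash_count o k t < tau))%N.

(** Lower bound: the largest [k] with [tau * 2 ^ k.+2 <= D] passes, and [2 ^ k] is within a factor
    [8 * tau] of [D]. Upper bound: a passing level with [2 ^ k > 16 * D] would make a majority of
    the seeds bad. *)
Lemma sketch_outputs_bounds (o : seeds N Om) e (t : 'I_T) :
  (forall k : 'I_K, (2 * #|[pred r | bad_hash (o r) k t]| < N)%N) ->
  (forall (k : 'I_K) (r : 'I_N), (noise_size e r k t.+1 <= thr)%N) ->
  let z := traj_outputs (sketch_init K L M T' (Om := Om)) (sketch_step h)
     (@sketch_estimate R K N L M T' Om thr) x (o, e) t in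
  (distinct x t)%:R / (8 * tau)%:R - 1 <= z /\ z <= 16 * (distinct x t)%:R.
Proof.
move=> good_hash good_noise z; set D := distinct x t.
have tau0 : (0 < tau)%N by lia.
pose passes k r := (thr < znorm (sketch_read (state o e t.+1) r k))%N.
have zE : z = (\max_(k < K | (N < 2 * #|[pred r | passes k r]|)%N) 2 ^ k)%:R.
  by rewrite /z ffunE.
have cardN (P : 'I_N -> bool) : (#|[pred r | P r]| + #|[pred r | ~~ P r]| = N)%N.
  by rewrite -[RHS]card_ord -(cardC [pred r | P r]); congr (_ + _)%N; apply: eq_card.
split.
  (* Below [4 * tau] there may be no such level, and the additive 1 suffices. *)
  have [Dlt|Dge] := ltnP D (4 * tau).
    rewrite lerBlDr (@le_trans _ _ 1)//; last by rewrite lerDr zE ler0n.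
    by rewrite ler_pdivrMr ?ltr0n ?muln_gt0// mul1r ler_nat; lia.
  pose k := trunc_log 2 (D %/ (4 * tau)).
  have q0 : (0 < D %/ (4 * tau))%N by rewrite divn_gt0// muln_gt0.
  have k1 : (2 ^ k * (4 * tau) <= D)%N.
    by rewrite -leq_divRL ?muln_gt0// trunc_logP.
  have k2 : (D < 2 ^ k.+1 * (4 * tau))%N.
    by rewrite -ltn_divLR ?muln_gt0// trunc_log_ltn.
  have Dn : (D <= 2 ^ K)%N by rewrite (leq_trans (max_card _))// card_ord.
  have kK : (k < K)%N.
    rewrite -(@ltn_exp2l 2)//; have : (0 < 2 ^ k)%N by rewrite expn_gt0.
    by nia.
  have maj : (N < 2 * #|[pred r | passes (Ordinal kK) r]|)%N.
    have le_bad : (#|[pred r | ~~ passes (Ordinal kK) r]| <=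
        #|[pred r | bad_hash (o r) k t]|)%N.
      apply: subset_leq_card; apply/fintype.subsetP => r; rewrite !inE /passes => np.
      apply/orP; right; rewrite (_ : tau * 2 ^ k.+2 <= D)%N; last first.
        by rewrite !expnS; lia.
      rewrite ltnNge; apply: contra np => ct.
      by apply: znorm_read_gt => //; exact: leq_trans ct.
    have cN := cardN (passes (Ordinal kK)).
    have lt_bad : (2 * #|[pred r | bad_hash (o r) k t]| < N)%N.
      exact: good_hash (Ordinal kK).
    by lia.
  have le_z : (2 ^ k)%:R <= z.
    by rewrite zE ler_nat (leq_bigmax_cond (Ordinal kK)).
  apply: le_trans le_z; rewrite lerBlDr (@le_trans _ _ (2 ^ k)%:R) ?lerDl//.
  rewrite ler_pdivrMr ?ltr0n ?muln_gt0// -natrM ler_nat.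
  by rewrite expnS in k2; lia.
rewrite zE -natrM ler_nat; apply/bigmax_leqP => k maj.
rewrite leqNgt; apply/negP => kD.
have : (#|[pred r | passes k r]| <= #|[pred r | bad_hash (o r) k t]|)%N.
  apply: subset_leq_card; apply/fintype.subsetP => r; rewrite !inE /passes => np.
  apply/orP; left; rewrite (_ : 16 * D <= 2 ^ k.+1)%N; last first.
    by rewrite expnS; lia.
  rewrite lt0n; apply: contraTneq np => c0; rewrite -leqNgt.
  exact: znorm_read_le.
by have := good_hash k; lia.
Qed.

Hypothesis tau32 : (32 <= tau)%N.
Hypothesis hash1 : forall k i, (k < K)%N ->
  (#|[pred o | h o i == k]| * 2 ^ k.+1 = #|Om|)%N.
Hypothesis hash2 : forall k i j, (k < K)%N -> i != j ->
  (#|[pred o | (h o i == k) && (h o j == k)]| * (2 ^ k.+1 * 2 ^ k.+1) = #|Om|)%N.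

(** * Moments of the level counts and failure of the seeds *)

Lemma hash_countE o k t :
  hash_count o k t = (\sum_(j | freq x t j != 0) (h o j == k))%N.
Proof.
by rewrite /hash_count -sum1_card big_mkcondr/=; apply: eq_bigr => j _; case: eqP.
Qed.

Lemma sum_hash_count k t : (k < K)%N ->
  (\sum_o hash_count o k t * 2 ^ k.+1 = distinct x t * #|Om|)%N.
Proof.
move=> kK; under eq_bigr do rewrite hash_countE.
rewrite -big_distrl/= exchange_big/= big_distrl/=.
rewrite (eq_bigr (fun=> #|Om|)) ?sum_nat_const//.
move=> j _; rewrite -(hash1 j kK); congr (_ * _)%N.
rewrite -[RHS]sum1_card [RHS]big_mkcond/=; apply: eq_bigr => o _.
by rewrite inE; case: eqP.
Qed.

(** Off-diagonal pairs contribute at most [D ^ 2] by pairwise independence, diagonal ones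
    [D * 2 ^ k.+1]. *)
Lemma sum_hash_count_sqr k t : (k < K)%N ->
  (\sum_o (hash_count o k t * 2 ^ k.+1) ^ 2 <=
   (distinct x t ^ 2 + distinct x t * 2 ^ k.+1) * #|Om|)%N.
Proof.
move=> kK; set A := (2 ^ k.+1)%N; set D := distinct x t.
have E o : ((hash_count o k t * A) ^ 2 =
    \sum_(i | freq x t i != 0) \sum_(j | freq x t j != 0)
       ((h o i == k) && (h o j == k)) * (A * A))%N.
  rewrite expnMn hash_countE !expnS !expn0 !muln1 big_distrlr/= big_distrl/=.
  apply: eq_bigr => i _; rewrite big_distrl/=; apply: eq_bigr => j _.
  by rewrite mulnb.
under eq_bigr do rewrite E.
rewrite exchange_big/=.
apply: (@leq_trans (\sum_(i | freq x t i != 0%R) (D + A) * #|Om|)%N); last first.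
  rewrite sum_nat_const -/(distinct x t) -/D mulnA; rewrite leq_mul2r.
  by apply/orP; right; rewrite expnS expn1 mulnDr.
apply: leq_sum => i fi; rewrite exchange_big/= (bigD1 i)//= mulnDl addnC.
apply: leq_add.
  apply: (@leq_trans (\sum_(j | (freq x t j != 0%R) && (j != i)) #|Om|)%N).
    apply: leq_sum => j /andP[_ ji].
    rewrite -big_distrl/= -(@hash2 k i j)// 1?eq_sym// leq_mul2r.
    apply/orP; right; rewrite -sum1_card [leqRHS]big_mkcond/=.
    by apply: leq_sum => o _; rewrite inE; case: ifP.
  rewrite sum_nat_const leq_mul2r; apply/orP; right.
  by apply: subset_leq_card; apply/fintype.subsetP => j; rewrite !inE => /andP[].
rewrite -(hash1 i kK) -/A -big_distrl/= [leqRHS]mulnCA leq_mul2r; apply/orP.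
right; rewrite -sum1_card [leqRHS]big_mkcond/=.
by apply: leq_sum => o _; rewrite andbb inE; case: eqP.
Qed.

(** Each kind of badness has probability at most [1 / 16]: by Markov when the mean is small, and by
    Chebyshev when it is large, where [4 * 2 ^ k.+1 / D <= 4 / (2 * tau)] and [tau >= 32]. *)
Lemma card_bad_hash k t : (k < K)%N ->
  (16 * #|[pred o | bad_hash o k t]| <= #|Om|)%N.
Proof.
move=> kK; set A := (2 ^ k.+1)%N; set D := distinct x t.
have A0 : (0 < A)%N by rewrite expn_gt0.
have kA : (2 ^ k.+2 = 2 * A)%N by rewrite expnS.
have S1 := sum_hash_count t kK; have S2 := sum_hash_count_sqr t kK.
rewrite -/A -/D in S1 S2.
rewrite /bad_hash -/A -/D kA.
have [small|large] := leqP (16 * D) A.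
  have -> : (tau * (2 * A) <= D)%N = false by nia.
  set X := #|_|; have : (X * A <= D * #|Om|)%N.
    rewrite -S1 /X -sum1_card big_distrl/= [leqRHS](bigID (mem [pred o |
       true && (0 < hash_count o k t)%N || false && (hash_count o k t < tau)%N]))/=.
    apply: leq_trans (leq_addr _ _); apply: leq_sum => o.
    by rewrite inE /= orbF => c0; rewrite leq_mul2r; apply/orP; right.
  by nia.
have [Dlarge|Dsmall] := leqP (tau * (2 * A)) D; last first.
  by rewrite (eq_card (_ : _ =i pred0)) ?card0// => o; rewrite !inE.
set X := #|_|.
(* Chebyshev: pairwise independence bounds the variance by the mean. *)
have cheb : \sum_o ((hash_count o k t * A)%:R - D%:R) ^+ 2 <= (D * A * #|Om|)%:R :> R.
  rewrite (eq_bigr (fun o => ((hash_count o k t * A) ^ 2)%:R -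
     (2 * D%:R) * (hash_count o k t * A)%:R + D%:R ^+ 2 : R)); last first.
    by move=> o _; rewrite natrX; ring.
  rewrite big_split/= sumrB -mulr_sumr -!natr_sum S1 sumr_const.
  move: S2; rewrite -(ler_nat R) => S2.
  apply: le_trans (lerD (lerB S2 (lexx _)) (lexx _)) _.
  rewrite -[_ *+ _]mulr_natr !(natrD, natrM, natrX); rewrite le_eqVlt.
  by apply/orP; left; apply/eqP; rewrite -/(#|Om|); ring.
have : X%:R * (D%:R ^+ 2 / 4) <= (D * A * #|Om|)%:R :> R.
  apply: le_trans cheb; rewrite mulr_natl -sumr_const.
  rewrite [leRHS](bigID (mem [pred o |
    false && (0 < hash_count o k t)%N || true && (hash_count o k t < tau)%N]))/=.
  rewrite -[leLHS]addr0 lerD//; last by apply: sumr_ge0 => o _; exact: sqr_ge0.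
  apply: ler_sum => o; rewrite inE/= => ct.
  have : (2 * (hash_count o k t * A) <= D)%N by nia.
  rewrite -(ler_nat R) natrM => c2.
  have D0 : 0 <= D%:R :> R by exact: ler0n.
  have c0 : 0 <= (hash_count o k t * A)%:R :> R by exact: ler0n.
  by nra.
have -> : X%:R * (D%:R ^+ 2 / 4) = (X * D ^ 2)%:R / 4 :> R.
  by rewrite natrM natrX mulrA.
rewrite ler_pdivrMr// -natrM ler_nat => XD.
have D0 : (0 < D)%N by nia.
have XD' : (X * D <= A * #|Om| * 4)%N.
  rewrite -(leq_pmul2r D0); nia.
have : (X * (tau * (2 * A)) <= A * #|Om| * 4)%N.
  by rewrite (leq_trans _ XD')// leq_mul2l Dlarge orbT.
have : (X * (32 * (2 * A)) <= X * (tau * (2 * A)))%N.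
  by rewrite leq_mul2l leq_mul2r tau32 !orbT.
nia.
Qed.

Hypothesis Om0 : (0 < #|Om|)%N.

(** Exponential Markov with weight 16 on bad seeds: each factor has mean at most [1 + 15 / 16 <= 2],
    while half the seeds being bad makes the product at least [4 ^+ N]. *)
Lemma prob_bad_seeds k t : (k < K)%N ->
  prob (seeds_law R N Om0)
    (fun o => (N <= 2 * #|[pred r | bad_hash (o r) k t]|)%N) <= 2 ^- N.
Proof.
move=> kK; pose w (o : Om) : R := if bad_hash o k t then 16 else 1.
have wE (o : seeds N Om) : \prod_r w (o r) = 16 ^+ #|[pred r | bad_hash (o r) k t]|.
  by rewrite -big_mkcond/= prodr_const.
have Om0R : 0 < #|Om|%:R :> R by rewrite ltr0n.
have w2 : \sum_o uniform_law R Om0 o * w o <= 2.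
  rewrite -mulr_sumr ler_pdivrMl// /w.
  rewrite (eq_bigr (fun o => 1 + 15 * (bad_hash o k t)%:R)); last first.
    by move=> o _; case: bad_hash; rewrite ?mulr1 ?mulr0 ?addr0//; ring.
  rewrite big_split/= -mulr_sumr sumr_const -natr_sum.
  have -> : (\sum_o bad_hash o k t = #|[pred o | bad_hash o k t]|)%N.
    rewrite -[RHS]sum1_card [RHS]big_mkcond/=; apply: eq_bigr => o _.
    by rewrite inE; case: bad_hash.
  have := card_bad_hash t kK; rewrite -(ler_nat R) natrM; lra.
pose F (o : seeds N Om) := \prod_r w (o r).
apply: le_trans (@markov_prob R _ _ _ F (4 ^+ N) _ _ _) _.
- by rewrite exprn_gt0.
- by move=> o; apply: prodr_ge0 => r _; rewrite /w; case: ifP.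
- move=> o maj; rewrite /F wE (_ : 16 = 4 ^+ 2); last by ring.
  by rewrite -exprM ler_weXn2l//; lra.
rewrite (pow_mass_moment _ (fun=> w)) prodr_const card_ord.
have -> : 2 ^- N = 2 ^+ N / 4 ^+ N :> R.
  rewrite (_ : 4 = 2 * 2); last by ring.
  by rewrite exprMn invfM mulrA divff ?mul1r// expf_neq0.
rewrite ler_pM2r ?invr_gt0 ?exprn_gt0//.
by apply: lerXn2r; rewrite ?nnegrE// sumr_ge0// => o _;
   rewrite mulr_ge0 ?mass_ge0// /w; case: ifP.
Qed.

Variable eps : R.
Hypothesis eps0 : 0 < eps.

(** The product over the tree nodes read at [t] is written as one over all times and cells, the form
    to which independence applies. *)
Lemma prod_block_cells (r : 'I_N) (k : 'I_K) t
    (F : 'I_T -> cell K N L -> R) :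
  \prod_(s < T) \prod_(j : cell K N L)
    (if [&& j.1.1 == r, j.1.2 == k, odd (t %/ 2 ^ j.2)
       & s == inord (block_start j.2 t)] then F s j else 1) =
  \prod_(l < L | odd (t %/ 2 ^ l)) F (inord (block_start l t)) (r, k, l).
Proof.
rewrite exchange_big/=.
rewrite (eq_bigr (fun j : cell K N L =>
  if [&& j.1.1 == r, j.1.2 == k & odd (t %/ 2 ^ j.2)]
  then F (inord (block_start j.2 t)) j else 1)); last first.
  move=> j _; case: ifP => [/and3P[-> -> ->]|nj]; last first.
    rewrite big1// => s _; case: ifP => // /and4P[a b c _].
    by rewrite a b c in nj.
  rewrite (bigD1 (inord (block_start j.2 t)))//= eqxx big1 ?mulr1// => s.
  by move=> /negbTE ->.
rewrite -big_mkcond/= (reindex_onto (fun l => (r, k, l)) snd)/=; last first.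
  by move=> [[r' k'] l] /= /and3P[/eqP -> /eqP ->].
by apply: eq_bigl => l; rewrite !eqxx/= andbT.
Qed.

(** Chernoff bound at exponent [eps / 2]: at most [L] nodes are read, each with moment at most 4. *)
Lemma prob_large_noise (r : 'I_N) (k : 'I_K) t :
  prob (pow_law 'I_T (fresh_law K N L M eps))
    (fun e => (thr < noise_size e r k t)%N) <=
  4 ^+ L * expR (- (eps / 2 * thr%:R)).
Proof.
pose g (z : 'I_M.+2) := expR (eps / 2 * (znorm z)%:R).
pose sel (s : 'I_T) (j : cell K N L) := [&& j.1.1 == r, j.1.2 == k,
  odd (t %/ 2 ^ j.2) & s == inord (block_start j.2 t)].
pose F (e : {ffun 'I_T -> registers K N L M}) :=
  \prod_s \prod_(j : cell K N L) (if sel s j then g (e s j) else 1).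
have FE e : F e = expR (eps / 2 * (noise_size e r k t)%:R).
  rewrite /F (prod_block_cells r k t (fun s j => g (e s j))) /noise_size.
  rewrite natr_sum mulr_sumr expR_sum.
  by apply: eq_bigr => l _.
rewrite expRN; apply: le_trans (@markov_prob R _ _ _ F
   (expR (eps / 2 * thr%:R)) _ _ _) _.
- exact: expR_gt0.
- by move=> e; rewrite FE expR_ge0.
- move=> e lt_e; rewrite FE ler_expR ler_pM2l ?divr_gt0// ler_nat.
  exact: ltnW.
rewrite ler_pM2r ?invr_gt0 ?expR_gt0// /F.
rewrite (noise_moment eps (fun s j z => if sel s j then g z else 1)).
pose m := \sum_z noise_law M eps z * g z.
have m4 : m <= 4 := noise_law_moment M eps0.
have m0 : 0 <= m.
  by apply: sumr_ge0 => z _; rewrite mulr_ge0 ?mass_ge0 ?expR_ge0.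
rewrite (eq_bigr (fun s => \prod_(j : cell K N L) (if sel s j then m else 1))); last first.
  move=> s _; apply: eq_bigr => j _; case: ifP => // _.
  by under eq_bigr do rewrite mulr1; rewrite mass_sum1.
rewrite (prod_block_cells r k t (fun _ _ => m)) prodr_const.
apply: (@le_trans _ _ (4 ^+ #|[pred l : 'I_L | odd (t %/ 2 ^ l)]|)).
  by apply: lerXn2r; rewrite ?nnegrE.
apply: ler_weXn2l; first by lra.
by rewrite -[leqRHS]card_ord max_card.
Qed.

Variables (m w : nat) (s0 : sketch_state K N L M T' Om).
Hypothesis le_card : (#|{: sketch_state K N L M T' Om}| <= #|{: memory m w}|)%N.

(** Union bound: over times and levels for the hashing, over times, levels and seeds for the
    noise. *)
Lemma sketch_accuracy :
  1 - ((T * K)%:R * 2 ^- N +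
       (T * (N * K))%:R * (4 ^+ L * expR (- (eps / 2 * thr%:R)))) <=
  output_prob (sketch_algorithm h Om0 eps thr s0 le_card) x
    (fun z => [forall t : 'I_T,
      ((distinct x t)%:R / (8 * tau)%:R - 1 <= z t) &&
      (z t <= 16 * (distinct x t)%:R + 0)]).
Proof.
rewrite output_probE probC lerD2l lerN2.
pose E1 (o : seeds N Om) := [exists tk : 'I_T * 'I_K,
  (N <= 2 * #|[pred r | bad_hash (o r) tk.2 tk.1]|)%N].
pose E2 (e : {ffun 'I_T -> registers K N L M}) :=
  [exists tkr : 'I_T * ('I_N * 'I_K),
    (thr < noise_size e tkr.2.1 tkr.2.2 tkr.1.+1)%N].
apply: (@le_trans _ _ (prob (pair_law (seeds_law R N Om0)
   (pow_law 'I_T (fresh_law K N L M eps))) (fun z => E1 z.1 || E2 z.2))).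
  apply: prob_le => -[a e] /=; apply: contraNT => /norP[/existsPn H1 /existsPn H2].
  apply/forallP => t; apply/andP; rewrite addr0.
  apply: sketch_outputs_bounds => [k|k r].
    by have := H1 (t, k); rewrite -ltnNge.
  by have := H2 (t, (r, k)); rewrite -leqNgt.
apply: le_trans (prob_setU _ _ _) _.
rewrite prob_fst prob_snd; apply: lerD.
  apply: le_trans (prob_union _ _) _.
  apply: (@le_trans _ _ (\sum_(tk : 'I_T * 'I_K) 2 ^- N)).
    by apply: ler_sum => tk _; apply: prob_bad_seeds.
  by rewrite sumr_const card_prod !card_ord mulr_natl.
apply: le_trans (prob_union _ _) _.
apply: (@le_trans _ _ (\sum_(tk : 'I_T * ('I_N * 'I_K))
   4 ^+ L * expR (- (eps / 2 * thr%:R)))).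
  by apply: ler_sum => tk _; apply: prob_large_noise.
by rewrite sumr_const !card_prod !card_ord mulr_natl.
Qed.

End Accuracy.

(** * Choice of the parameters *)

(* For [K = 0] the space bound allows no memory at all, but then [D <= 1]. *)
Section Constant.
Variables (R : realType) (n w : nat).

Lemma card_unit_memory : (#|{: unit}| <= #|{: memory 0 w}|)%N.
Proof. by rewrite card_unit card_tuple. Qed.

Definition unit_law : finite_law R unit :=
  @uniform_law R unit (eq_leq (esym card_unit)).

Definition constant_algorithm : streaming_algorithm R n 0 w :=
  noise_algorithm unit_law unit_law id (fun _ _ _ => tt) (fun=> 0)
    card_unit_memory tt.

Lemma constant_zCDP T rho : 0 < rho -> zCDP T constant_algorithm rho.
Proof.
(* Streams of length 0 have no neighbors. *)
case: T => [|T'] rho0 x x' nb zeta z1.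
  by move: (max_card [pred i | x i != x' i]); rewrite nb card_ord.
pose p := pair_law unit_law (pow_law 'I_T'.+1 unit_law).
have p0 z : 0 < p z.
  by rewrite mulr_gt0// ?prodr_gt0// => *; rewrite /= invr_gt0 ltr0n card_unit.
pose z0 : {ffun 'I_T'.+1 -> R} := [ffun=> 0].
have lawE (y : stream n T'.+1) z :
    output_law constant_algorithm y z = \sum_(s | z0 == z) p s.
  rewrite /output_law output_probE; apply: eq_bigl => s /=.
  by congr (_ == z); apply/ffunP => t; rewrite !ffunE.
apply: (@le_trans _ _ ((zeta - 1)^-1 * 0)%:E).
  apply: (@renyi_pushforward_le R _ _ p p (fun=> z0)) => //.
  rewrite expR0 -(mass_sum1 p); apply: ler_sum => z _.
  by rewrite divff ?powR1 ?mulr1// gt_eqF.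
by rewrite mulr0 lee_fin mulr_ge0 ?ltW// (lt_trans _ z1).
Qed.

Lemma constant_output_prob T' (x : stream n T'.+1) (E : pred {ffun 'I_T'.+1 -> R}) :
  E [ffun=> 0] -> output_prob constant_algorithm x E = 1.
Proof.
move=> E0; rewrite output_probE.
rewrite -(mass_sum1 (pair_law unit_law (pow_law 'I_T'.+1 unit_law))).
apply: eq_bigl => s.
have -> : traj_outputs id (fun _ _ _ => tt) (fun=> 0) x s = [ffun=> 0]
    :> {ffun 'I_T'.+1 -> R}.
  by apply/ffunP => t; rewrite !ffunE.
by rewrite E0.
Qed.

End Constant.

Lemma card_memory m w : #|{: memory m w}| = (2 ^ (w * m))%N.
Proof. by rewrite card_tuple card_tuple card_bool expnM. Qed.

Lemma card_sketch_state K N L M T' (Om : finType) :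
  #|{: sketch_state K N L M T' Om}| =
  (#|Om| ^ N * T'.+2 * M.+2 ^ (N * K * L))%N.
Proof. by rewrite !card_prod !card_ffun !card_prod !card_ord. Qed.

Lemma leq_expl m1 m2 k : (m1 <= m2)%N -> (m1 ^ k <= m2 ^ k)%N.
Proof. by case: k => // k; rewrite leq_exp2r. Qed.

Section Exponents.
Local Open Scope nat_scope.

Lemma level_bound a T K l : 2 ^ K <= T ^ a -> T <= 2 ^ l -> K <= a * l.
Proof.
move=> KT Tl.
by rewrite -(@leq_exp2l 2)// (leq_trans KT)// mulnC expnM leq_expl.
Qed.

Lemma hash_failure_bound a d T K l : 2 ^ K <= T ^ a -> T <= 2 ^ l ->
  T * K * 2 ^ (d.+1 * l) <= 2 ^ ((a + d + 2) * l).
Proof.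
move=> KT Tl; set n0 := a + d + 2.
have -> : n0 * l = l + a * l + d.+1 * l by rewrite /n0; lia.
rewrite !expnD leq_mul2r leq_mul ?orbT//.
by rewrite (leq_trans (level_bound KT Tl))// ltnW// ltn_expl.
Qed.

Lemma noise_failure_bound a d n0 T K l : 2 ^ K <= T ^ a -> T <= 2 ^ l -> 0 < l ->
  T * (n0 * l * K) * 4 ^ l.+1 * 2 ^ (d.+1 * l) <= 2 ^ ((n0 + a + d + 6) * l).
Proof.
move=> KT Tl l0; set c1 := n0 + a + d + 6.
have -> : c1 * l = l + (n0 * l + a * l) + (4 * l) + d.+1 * l by rewrite /c1; lia.
rewrite !expnD leq_mul2r; apply/orP; right; apply: leq_mul.
  apply: leq_mul => //; apply: leq_mul; first by rewrite ltnW// ltn_expl.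
  by rewrite (leq_trans (level_bound KT Tl))// ltnW// ltn_expl.
have -> : 4 ^ l.+1 = 2 ^ (2 * l.+1) by rewrite expnM.
by rewrite -!expnD leq_exp2l//; lia.
Qed.

Lemma double_expn_bound d T l : T <= 2 ^ l -> 0 < l -> 2 * T ^ d <= 2 ^ (d.+1 * l).
Proof.
move=> Tl l0; rewrite (mulSn d) expnD leq_mul//.
  by rewrite -[leqLHS]expn1 leq_exp2l.
by rewrite mulnC expnM leq_expl.
Qed.

(** In bits, the seeds, the clock and the registers together take at most
    [(6 * n0 + 2) * K * l ^ 3]; one factor [l] is then traded for the word size by [l <= e * w]. *)
Lemma state_bound n0 e T K w l : 0 < K -> T <= 2 ^ l -> 0 < l -> l <= e * w ->
  (2 ^ K * 2 ^ K) ^ (n0 * l) * T.+1 *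
  (2 ^ l.+1) ^ (n0 * l * K * l.+1) <= 2 ^ (w * ((6 * n0 + 2) * e * K * l ^ 2)).
Proof.
move=> K0 Tl l0 lw.
have T1 : T.+1 <= 2 ^ l.+1 by rewrite expnS mul2n -addnn -addn1 leq_add// expn_gt0.
apply: (@leq_trans (2 ^ ((K + K) * (n0 * l)) * 2 ^ l.+1 *
   2 ^ (l.+1 * (n0 * l * K * l.+1)))).
  by rewrite -expnD -!expnM leq_mul2r leq_mul2l T1 !orbT.
rewrite -!expnD leq_exp2l//.
have -> : w * ((6 * n0 + 2) * e * K * l ^ 2) =
  (6 * n0 + 2) * K * l ^ 2 * (e * w) by ring.
apply: (@leq_trans ((6 * n0 + 2) * K * l ^ 2 * l)); last by rewrite leq_mul2l lw orbT.
have l1 : l.+1 <= 2 * l by lia.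
have b1 : l <= K * l ^ 3.
  by rewrite -[leqLHS]mul1n leq_mul// expnS leq_pmulr// expn_gt0 l0.
have b2 : (K + K) * (n0 * l) <= 2 * n0 * (K * l ^ 3).
  have -> : (K + K) * (n0 * l) = 2 * n0 * (K * l) by ring.
  by rewrite leq_mul2l leq_mul2l expnS leq_pmulr ?orbT// expn_gt0 l0.
have b3 : l.+1 * (n0 * l * K * l.+1) <= 4 * n0 * (K * l ^ 3).
  have -> : 4 * n0 * (K * l ^ 3) = 2 * l * (n0 * l * K * (2 * l)) by ring.
  by rewrite leq_mul// leq_mul.
have -> : (6 * n0 + 2) * K * l ^ 2 * l =
  2 * n0 * (K * l ^ 3) + 2 * (K * l ^ 3) + 4 * n0 * (K * l ^ 3) by ring.
by rewrite !leq_add// (leq_trans l1)// leq_mul2l b1 orbT.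
Qed.

End Exponents.

(* The hidden constants: n <= T ^ a is "n <= poly(T)", T ^- d is the failure
   probability "1/poly(T)", T <= 2 ^ (e * w) says that words have
   w = Omega(log T) bits, and C is the constant of all the O(.); c is absolute. *)
Theorem theorem3p1 (R : realType) :
  exists c : R, 0 < c /\
  forall a d e : nat, exists C : R, 0 < C /\
  forall (T K w : nat) (rho : R),
    0 < rho -> (2 ^ K <= T ^ a)%N -> (T <= 2 ^ (e * w))%N ->
    exists (m : nat) (A : streaming_algorithm R (2 ^ K) m w),
      [/\ zCDP T A rho,
          m%:R <= C * (ln (2 ^ K)%:R * ln T%:R ^+ 2)
        & rho <= c * ln T%:R ^+ 4 ->
          exists alpha beta : R,
            [/\ 1 <= alpha <= C * (ln T%:R ^+ 2 / Num.sqrt rho),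
                0 <= beta <= C * (ln T%:R ^+ 2 / Num.sqrt rho)
              & forall x : stream (2 ^ K) T, strict_turnstile x ->
                  solves_distinct_elements A x alpha beta (T%:R ^- d)]].
Proof.
exists 1; split=> // a d e.
pose n0 := (a + d + 2)%N; pose c1 := (n0 + a + d + 6)%N.
(* The second bound comes from [alpha = 16 * 8 * tau = 256 * thr + 4096] and [thr <= y + 1]. *)
have [C [C_mem C_err]] : exists C : R, 32 * ((6 * n0 + 2) * e)%:R <= C /\
    256 * (192 * (c1 * n0)%:R) + 4352 <= C.
  set u := 32 * _; set v := 256 * _ + _.
  by exists (Num.max u v); rewrite !le_max !lexx orbT.
have C1 : 1 <= C by have := ler0n R (c1 * n0); lra.
exists C; split; first exact: lt_le_trans C1.
move=> T K w rho rho0 KT Tw.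
have sq0 : 0 < Num.sqrt rho by rewrite sqrtr_gt0.
(* With [c = 1] the target error is at least 1, so additive constants are absorbed into [C]. *)
have G1 : rho <= 1 * ln T%:R ^+ 4 -> 1 <= ln T%:R ^+ 2 / Num.sqrt rho.
  move=> le_rho; rewrite ler_pdivlMr// mul1r -[leRHS]ger0_norm ?sqr_ge0//.
  by rewrite -sqrtr_sqr ler_wsqrtr// -exprM -[leRHS]mul1r.
have [K0|K0] := posnP K.
  exists 0%N, (constant_algorithm R (2 ^ K) w); split.
  - exact: constant_zCDP.
  - by rewrite K0 expn0 ln1 mul0r mulr0.
  move=> le_rho; have G := G1 le_rho.
  have CG : 1 <= C * (ln T%:R ^+ 2 / Num.sqrt rho) by rewrite -[leLHS]mulr1 ler_pM.
  exists 1, 1; split; rewrite ?lexx ?ler01//.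
  case: T {KT Tw G CG G1} le_rho => [|T'] le_rho x _.
    (* For [T = 0] the convention [ln 0 = 0] would force [rho <= 0]. *)
    by move: rho0; rewrite ltNge (le_trans le_rho)// ln0// expr0n mulr0.
  exists 1, 1, 1, 0; split; first by rewrite mulr1.
  split; first by rewrite addr0.
  rewrite constant_output_prob; first by rewrite gerBl invr_ge0 exprn_ge0.
  apply/forallP => t; rewrite ffunE divr1 mul1r addr0 ler0n andbT subr_le0.
  by rewrite lern1 (leq_trans (max_card _))// card_ord K0.
have T2 : (2 <= T)%N.
  have : (2 <= T ^ a)%N by rewrite (leq_trans _ KT)// -[leqLHS]expn1 leq_exp2l.
  case: T {Tw KT G1} => [|[|//]]; last by rewrite exp1n.
  by case: (a) => [|a'] //; rewrite exp0n.
pose l := up_log 2 T.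
have l0 : (0 < l)%N by rewrite up_log_gt0.
have Tl : (T <= 2 ^ l)%N by exact: up_logP.
have lw : (l <= e * w)%N by exact: up_log_min.
have ln2 : 1 / 2 <= ln 2%:R :> R.
  have := @le_ln1Dx R (- (1 / 2)).
  rewrite (_ : 1 + - (1 / 2) = 2%:R^-1); last by field.
  by rewrite lnV ?posrE// => /(_ ltac:(lra)); lra.
have lnX2 k : ln (2 ^ k)%:R = k%:R * ln 2%:R :> R.
  by rewrite natrX lnXn ?ltr0n// -[LHS]mulr_natl.
have lnT : 0 < ln T%:R :> R by rewrite ln_gt0// ltr1n.
have l_ln : l%:R <= 4 * ln T%:R :> R.
  have : ln (2 ^ l.-1)%:R <= ln T%:R :> R.
    rewrite ler_ln ?posrE ?ltr0n ?expn_gt0// ?(leq_trans _ T2)//.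
    by rewrite ler_nat ltnW// up_log_gtn.
  have : ln 2%:R <= ln T%:R :> R.
    by rewrite ler_ln ?posrE ?ltr0n ?(leq_trans _ T2)// ler_nat.
  rewrite lnX2.
  have -> : l%:R = l.-1%:R + 1 :> R by rewrite natr1 prednK.
  have : 0 <= l.-1%:R :> R by [].
  move: (l.-1%:R) (ln T%:R) (ln 2%:R) ln2 => u v b b2 u0 bv ubv.
by have := ler_wpM2l u0 b2; lra.
have l2 : l%:R ^+ 2 <= 16 * ln T%:R ^+ 2 :> R.
  have -> : 16 * ln T%:R ^+ 2 = (4 * ln T%:R) ^+ 2 :> R by ring.
  by apply: lerXn2r; rewrite // nnegrE// mulr_ge0// ltW.
have n00 : (0 < n0)%N by rewrite addn_gt0 orbT.
pose N := (n0 * l)%N; pose L := l.+1.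
(* The group order is at least [2 * T], and each register takes [l.+1] bits. *)
have [M ME] : exists M, (M.+2 = 2 ^ l.+1)%N.
  exists (2 ^ l.+1 - 2)%N; have p2 : (2 <= 2 ^ l.+1)%N.
    by rewrite -[leqLHS]expn1 leq_exp2l.
  by rewrite -addn2 subnK.
have [Om [h [cOm hash1 hash2]]] := pairwise_hash K0.
have Om0 : (0 < #|Om|)%N by rewrite cOm muln_gt0 expn_gt0.
case: T T2 => // T' T2 in KT Tw G1 l l0 Tl lw lnT l_ln l2 N L M ME *.
have /card_gt0P[om _] := Om0.
pose s0 : sketch_state K N L M T' Om := ([ffun=> om], ord0, [ffun=> 0]).
pose m := ((6 * n0 + 2) * e * K * l ^ 2)%N.
have le_card : (#|{: sketch_state K N L M T' Om}| <= #|{: memory m w}|)%N.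
  by rewrite card_sketch_state card_memory cOm ME; exact: state_bound.
have lR : 0 < l%:R :> R by rewrite ltr0n.
have n0R : 1 <= n0%:R :> R by rewrite ler1n.
(* Then [16 * N * L * eps ^+ 2] is [rho * 16 * (l + 1) / (36 * n0 * l)], at most [rho] because
   [l + 1 <= 2 * l]. *)
pose eps : R := Num.sqrt rho / (6 * n0%:R * l%:R).
have den0 : 0 < 6 * n0%:R * l%:R :> R by rewrite !mulr_gt0// (lt_le_trans _ n0R).
have eps0 : 0 < eps by rewrite divr_gt0.
(* This solves [eps / 2 * y = c1 * l], so noise above [y] has a tail factor of at most
   [2 ^- (c1 * l)]. *)
pose y : R := 2 * c1%:R * l%:R / eps.
have y0 : 0 <= y by rewrite divr_ge0 ?(ltW eps0)// !mulr_ge0.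
have [thr thr_gt thr_le] : exists2 thr : nat, y <= thr%:R & thr%:R <= y + 1.
  exists (Num.truncn y).+1; first by rewrite ltW// truncnS_gt.
  by rewrite -natr1 lerD2r truncn_le.
pose tau := (2 * thr + 32)%N.
exists m, (sketch_algorithm h Om0 eps thr s0 le_card); split.
- apply: sketch_zCDP => //.
  have -> : 16 * (N * L)%:R * eps ^+ 2 =
      rho * (16 * (l%:R + 1) / (36 * n0%:R * l%:R)).
    rewrite /eps expr_div_n sqr_sqrtr ?(ltW rho0)// /N /L !natrM -[l.+1%:R]natr1.
    by field; rewrite !gt_eqF// (lt_le_trans _ n0R).
  rewrite -[leRHS]mulr1 ler_pM2l// ler_pdivrMr; last first.
    by rewrite !mulr_gt0// (lt_le_trans _ n0R).
  have l1 : 1 <= l%:R :> R by rewrite ler1n.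
  by nra.
- rewrite lnX2.
  have -> : m%:R = ((6 * n0 + 2) * e)%:R * K%:R * l%:R ^+ 2 :> R.
    by rewrite /m natrM natrM natrX.
  apply: (@le_trans _ _ (32 * ((6 * n0 + 2) * e)%:R *
      (K%:R * ln 2%:R * ln T'.+1%:R ^+ 2))); last first.
    apply: ler_wpM2r C_mem.
    by rewrite !mulr_ge0 ?ln_ge0 ?ler1n ?sqr_ge0.
  apply: (@le_trans _ _ (((6 * n0 + 2) * e)%:R * K%:R * (16 * ln T'.+1%:R ^+ 2))).
    by rewrite ler_wpM2l// mulr_ge0.
  set u : R := _%:R; set v : R := K%:R; set t := _ ^+ 2.
  have uvt : 0 <= u * v * t by rewrite !mulr_ge0 // ltW.
  have -> : 32 * u * (v * ln 2%:R * t) = (u * v * t) * (32 * ln 2%:R) by ring.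
  have -> : u * v * (16 * t) = (u * v * t) * 16 by ring.
  by rewrite ler_wpM2l//; lra.
move=> le_rho; have G := G1 le_rho; set H := _ / _ in G *.
have y_le : y <= 192 * (c1 * n0)%:R * H.
  have -> : y = 12 * (c1 * n0)%:R * l%:R ^+ 2 / Num.sqrt rho.
    rewrite /y /eps natrM; field.
    by rewrite !gt_eqF// (lt_le_trans _ n0R).
  rewrite /H [leRHS]mulrA ler_pM2r ?invr_gt0//.
  have -> : 192 * (c1 * n0)%:R * ln T'.+1%:R ^+ 2 =
    12 * (c1 * n0)%:R * (16 * ln T'.+1%:R ^+ 2) :> R by ring.
  by rewrite ler_wpM2l// mulr_ge0.
have CH : (256 * (192 * (c1 * n0)%:R) + 4352) * H <= C * H.
  by rewrite ler_wpM2r ?(le_trans _ G).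
have tau1 : 1 <= tau%:R :> R by rewrite ler1n addn_gt0 orbT.
exists ((8 * tau)%:R * 16), 1; split.
- apply/andP; split.
    by rewrite natrM; lra.
  apply: le_trans CH; rewrite natrM /tau natrD natrM.
  move: (192 * _) y_le => Z y_le.
  by lra.
- rewrite ler01/=; apply: (@le_trans _ _ (C * 1)); first by rewrite mulr1.
  by rewrite ler_wpM2l// (le_trans _ C1).
move=> x strict.
exists (8 * tau)%:R, 16, 1, 0; split.
  by split; [rewrite ler1n muln_gt0 addn_gt0 orbT|rewrite ler1n|].
split; first by rewrite addr0.
apply: le_trans (sketch_accuracy strict _ _ _ _ hash1 hash2 Om0 eps0 s0 le_card).
- rewrite lerD2l lerN2.
  (* Each source of failure gets at most [2 ^- (d.+1 * l)]; the spare factor [2 ^ l] absorbs the 2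
     of their sum. *)
  have two_gt k : 0 < 2 ^+ k :> R by rewrite exprn_gt0.
  have hb : (T'.+1 * K)%:R * 2 ^- N <= 2 ^- (d.+1 * l) :> R.
    rewrite -ler_pdivlMr ?invr_gt0// invrK mulrC ler_pdivlMr//.
    by rewrite -!natrX -natrM ler_nat; exact: hash_failure_bound KT Tl.
  have nb : (T'.+1 * (N * K))%:R * (4 ^+ L * expR (- (eps / 2 * thr%:R))) <=
      2 ^- (d.+1 * l).
    apply: (@le_trans _ _ ((T'.+1 * (N * K) * 4 ^ L)%:R * 2 ^- (c1 * l))).
      have -> : (T'.+1 * (N * K) * 4 ^ L)%:R = (T'.+1 * (N * K))%:R * 4 ^+ L :> R.
        by rewrite natrM natrX.
      rewrite -[leRHS]mulrA ler_wpM2l// ler_wpM2l ?exprn_ge0//.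
      rewrite expRN lef_pV2 ?posrE ?expR_gt0//.
      apply: (@le_trans _ _ (expR ((c1 * l)%:R * 1))).
        rewrite expRM_natl; apply: lerXn2r; rewrite ?nnegrE ?expR_ge0//.
        by have := @expR_ge1Dx R 1; lra.
      rewrite ler_expR mulr1.
      have -> : (c1 * l)%:R = eps / 2 * y.
        by rewrite /y natrM; field; rewrite gt_eqF.
      by rewrite ler_pM2l// divr_gt0.
    rewrite -ler_pdivlMr ?invr_gt0// invrK mulrC ler_pdivlMr//.
    rewrite -!natrX -natrM ler_nat; exact: noise_failure_bound KT Tl l0.
  apply: le_trans (lerD hb nb) _.
  have -> : 2 ^- (d.+1 * l) + 2 ^- (d.+1 * l) = 2 / 2 ^+ (d.+1 * l) :> R by ring.
  rewrite ler_pdivrMr// mulrC ler_pdivlMr ?exprn_gt0 ?ltr0n//.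
  by have := double_expn_bound d Tl l0; rewrite -(ler_nat R) natrM !natrX.
- by rewrite (leq_ltn_trans Tl)// ltn_exp2l.
- by rewrite ME expnS mul2n leq_double.
- by rewrite /tau -addn1 leq_add.
- by rewrite leq_addl.
Qed.
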